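(* For every integer $n \geq 2$ there exists a bounded RL-domain $\Omega$ of order $n$ and connectivity $k = n+1$ whose landscape function $v$ has exactly $4n + k - 6 = 5n - 5$ critical points in $\Omega$.
   Context: All domains $\Omega\subset\mathbb{C}$ are bounded, open, connected and finitely connected. The connectivity $k$ of $\Omega$ is the number of connected components of $\partial\Omega$. The landscape function $v$ of $\Omega$ is the unique solution of $\Delta v = -2$ in $\Omega$, $v = 0$ on $\partial\Omega$. A critical point of $v$ is a point $z\in\Omega$ with $\nabla v(z) = 0$; distinct points are counted. RL-domain (''rational landscape domain''): a domain $\Omega$ such that $\partial\Omega$ is a subset of $\{z : |z|^2 = f(z) + \overline{f(z)}\}$, where the derivative $f'$ is a rational function. Here $f$ itself may be multivalued (it may involve logarithms), but $f+\overline{f} = 2\operatorname{Re} f$ is single-valued, and $\operatorname{Re} f$ is the harmonic function on $\Omega$ with boundary values $|z|^2/2$, so that the landscape function is $v(z) = \operatorname{Re} f(z) - \frac{|z|^2}{2}$. The order of the RL-domain $\Omega$ is the degree of the rational function $f'$ (the maximum of the degrees of numerator and denominator in lowest terms). *)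

(* Defs.v *)
(* Written with MathComp-Analysis; the complex plane is R[i] for R : realType. *)
From HB Require Import structures.
From mathcomp Require Import all_boot all_order all_algebra.
From mathcomp Require Export complex.
From mathcomp Require Import all_classical all_reals all_analysis.

Set Implicit Arguments.
Unset Strict Implicit.
Unset Printing Implicit Defensive.

Import Order.TTheory GRing.Theory Num.Theory.
Import numFieldNormedType.Exports.

Local Open Scope classical_set_scope.
Local Open Scope ring_scope.
Local Open Scope complex_scope.
Local Open Scope card_scope.

(* The library equips only R[i]^o with the metric topology of the modulus; it
   is transported to R[i] itself. *)
#[warnings="-redundant-canonical-projection"]
HB.instance Definition _ (R : rcfType) := NormedModule.copy R[i] R[i]^o.

Section Landscape.
Variable R : realType.
Implicit Types (Omega : set R[i]) (u v : R[i] -> R) (p q : {poly R[i]}).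

Definition boundary Omega : set R[i] := closure Omega `\` interior Omega.

Definition boundary_components Omega : set (set R[i]) :=
  connected_component (boundary Omega) @` boundary Omega.

Definition bounded_domain Omega : Prop :=
  [/\ Omega !=set0, open Omega, connected Omega, bounded_set Omega
    & finite_set (boundary_components Omega)].

Definition has_connectivity Omega (k : nat) : Prop :=
  boundary_components Omega #= `I_k.

(* Restrictions of v to the horizontal and vertical lines through z, and the
   corresponding partial derivatives; [derive1] is meaningful only together
   with the [derivable] hypotheses of [C1_on]. *)
Definition hline v (z : R[i]) : R -> R := fun t => v (t +i* complex.Im z).
Definition vline v (z : R[i]) : R -> R := fun t => v (complex.Re z +i* t).

Definition dx v : R[i] -> R := fun z => derive1 (hline v z) (complex.Re z).
Definition dy v : R[i] -> R := fun z => derive1 (vline v z) (complex.Im z).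

Definition C1_on Omega v : Prop :=
  forall z, Omega z ->
    [/\ derivable (hline v z) (complex.Re z) 1,
        derivable (vline v z) (complex.Im z) 1,
        {for z, continuous (dx v)} & {for z, continuous (dy v)}].

Definition C2_on Omega v : Prop :=
  [/\ C1_on Omega v, C1_on Omega (dx v) & C1_on Omega (dy v)].

Definition laplacian v : R[i] -> R := fun z => dx (dx v) z + dy (dy v) z.

(* Values of v outside the closure of Omega are irrelevant. *)
Definition landscape_function Omega v : Prop :=
  [/\ C2_on Omega v,
      {in Omega, forall z, laplacian v z = - 2},
      {within closure Omega, continuous v}
    & {in boundary Omega, forall z, v z = 0}].

Definition critical_points Omega v : set R[i] :=
  [set z | [/\ Omega z, dx v z = 0 & dy v z = 0]].

(* u = Re f for a possibly multivalued f with f' = p / q: the function u is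
   single-valued off the zeros of q, and near each point it is the real part
   of a local holomorphic branch F of f. *)
Definition is_Re_primitive p q u : Prop :=
  forall z0, q.[z0] != 0 ->
    exists F : R[i] -> R[i],
      \forall z \near z0, is_derive z (1 : R[i]) F (p.[z] / q.[z]) /\
                          complex.Re (F z) = u z.

(* f' = p / q in lowest terms, so that its degree is the maximum of the degrees
   of p and q.  As f lives off the poles, i.e. off the zeros of q, the locus
   |z|^2 = f + conj f = 2 u consists of non-poles.  That u is harmonic in Omega
   with boundary values |z|^2 / 2 follows from the last three clauses. *)
Definition RL_domain_of_order (n : nat) Omega : Prop :=
  bounded_domain Omega /\
  exists (p q : {poly R[i]}) (u : R[i] -> R),
    [/\ coprimep p q /\ (maxn (size p) (size q)).-1 = n,
        is_Re_primitive p q u,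
        Omega `<=` [set z | q.[z] != 0]
      & boundary Omega `<=`
          [set z | q.[z] != 0 /\ `|z| ^+ 2 = (2 * u z)%:C]].

End Landscape.

(* Main.v *)
(* Put point masses c_s > 0 at n points s. With V(z) = sum_s c_s ln|z - s| - |z|^2/2
   one has V = -oo at the masses and at infinity, so for large C the set V > -C is a
   large disc with n small holes. Its boundary is a level set of V, its landscape function
   is V + C, and the critical points of V are the solutions of
   conj z = sum_s c_s/(z - s), the gravitational lens equation. All of them lie in the
   domain once C is large, and it remains to exhibit n masses with 5n - 5 solutions.
   Put the masses at the m-th roots of A > 0 and possibly a small mass e at 0 (Rhie's
   lens). Multiplying the equation by z shows that z^m is real; with t = |z| and
   z^m = t^m or z^m = -t^m it becomes (t^2 - e)(t^m - A) = t^m or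
   (t^2 - e)(t^m + A) = t^m, and each positive root t gives m solutions z.
   - n = 2, 3: take m = n and e = 0. The two equations have 1 + 1, respectively 1 + 2,
     roots, and z = 0 is a further solution.
   - n >= 4: take m = n - 1 and e small and positive. They have 2 + 3 roots. *)
Require Import Defs.
From mathcomp Require Import all_boot all_order all_algebra.
From mathcomp Require separable polyrcf.
From mathcomp Require Import all_classical all_reals all_analysis.
From mathcomp Require Import ring lra.

Set Implicit Arguments.
Unset Strict Implicit.
Unset Printing Implicit Defensive.

Import Order.TTheory GRing.Theory Num.Theory.
Import numFieldNormedType.Exports.
Import Normc.

Local Open Scope classical_set_scope.
Local Open Scope ring_scope.
Local Open Scope complex_scope.
Local Open Scope card_scope.

(** * The topology of the complex plane *)

(** The geometry of the level set needs neither a gradient nor the Jordan curve theorem. Near each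
    mass and far from the origin, V is strictly monotone along rays, so inside thin annuli the set V
    = -C is a graph over the angle, and between these annuli V stays above -C. The domain is
    connected because it becomes star-shaped about 0 once the holes are filled; the holes are then
    cut out one at a time. The counts must be exact, so roots have to be bounded from above as well.
    For n >= 4 this comes from Rolle's theorem and from monotonicity. Two and three masses need
    their own lenses: with m <= 2 and a central mass, the second radial equation has fewer than
    three positive roots. There A is chosen so that all radii are rational and the polynomials
    factor explicitly. *)

Section Plane.
Variable R : realType.
Implicit Types (z w : R[i]).

Lemma normCE z : `|z| = (normc z)%:C.
Proof. by []. Qed.

(** The norm of [R[i]] takes values in [R[i]], and a positive radius there has imaginary part 0.
    Passing to the real modulus [normc] opens all later estimates to real arithmetic. *)
Lemma nbhsCP z (P : set R[i]) :
  nbhs z P <-> exists2 e : R, 0 < e & forall w, normc (w - z) < e -> P w.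
Proof.
split.
  move=> /nbhs_normP[e /= e0 eP].
  exists (complex.Re e).
    by move: e0; rewrite ltcE => /andP[_].
  move=> w wz; apply: eP => /=.
  move: e0; rewrite ltcE /= => /andP[/eqP e0 _].
  by rewrite distrC normCE ltcE /= e0 eqxx.
move=> [e e0 eP]; apply/nbhs_normP; exists e%:C; first by rewrite /= ltcR.
by move=> w /=; rewrite distrC normCE ltcR; exact: eP.
Qed.

Lemma continuousCP (f : R[i] -> R) z : {for z, continuous f} <->
  forall e : R, 0 < e -> exists2 d : R, 0 < d & forall w, normc (w - z) < d -> `|f w - f z| < e.
Proof.
split => [/cvgrPdist_lt cf e e0|cf].
  have /nbhsCP[d d0 dP] := cf _ e0.
  by exists d => // w /dP; rewrite distrC.
move=> P /nbhs_ballP[e /= e0 eP]; have [d d0 dP] := cf _ e0.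
apply/nbhsCP; exists d => // w /dP; rewrite distrC => fwz; exact: eP.
Qed.

Lemma Re_le_normc z : `|complex.Re z| <= normc z.
Proof. by rewrite -lecR; exact: normc_ge_Re. Qed.

Lemma Im_le_normc z : `|complex.Im z| <= normc z.
Proof.
case: z => x y /=; rewrite -(ler_sqr (normr_ge0 _)) ?nnegrE ?sqrtr_ge0//.
rewrite sqr_sqrtr ?addr_ge0 ?sqr_ge0//.
by rewrite real_normK ?num_real// lerDr sqr_ge0.
Qed.

Lemma normc_ge0 z : 0 <= normc z.
Proof. by case: z => x y; exact: sqrtr_ge0. Qed.

Lemma normc_gt0 z : (0 < normc z) = (z != 0).
Proof.
rewrite lt_def normc_ge0 andbT; apply/idP/idP; apply: contra => /eqP.
  by move=> ->; rewrite normc0.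
by move=> /eq0_normc ->.
Qed.

Lemma normcB z w : normc (z - w) = normc (w - z).
Proof. by rewrite -normcN opprB. Qed.

Lemma normc_sqr z : normc z ^+ 2 = complex.Re z ^+ 2 + complex.Im z ^+ 2.
Proof. by case: z => x y /=; rewrite sqr_sqrtr ?addr_ge0 ?sqr_ge0. Qed.

Lemma normc_triangle x y z : normc (x - z) <= normc (x - y) + normc (y - z).
Proof. by have := le_normcD (x - y) (y - z); rewrite addrA subrK. Qed.

Lemma normc_dist z w : `|normc z - normc w| <= normc (z - w).
Proof.
rewrite ler_norml; have := normc_triangle z w 0; have := normc_triangle w z 0.
rewrite !subr0 (normcB w) => h1 h2; lra.
Qed.

Lemma normcR (x : R) : normc x%:C = `|x|.
Proof. by rewrite /= expr0n addr0 sqrtr_sqr. Qed.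

Lemma normcX z n : normc (z ^+ n) = normc z ^+ n.
Proof. by elim: n => [|n IH]; rewrite ?expr0 ?normc1// !exprS normcM IH. Qed.

Lemma normc_continuous : continuous (@normc R).
Proof.
move=> z; apply/continuousCP => e e0; exists e => // w; exact/le_lt_trans/normc_dist.
Qed.

Lemma Re_continuous : continuous (@complex.Re R).
Proof.
move=> z; apply/continuousCP => e e0; exists e => // w.
by apply/le_lt_trans; have := Re_le_normc (w - z); case: w z => ? ? [].
Qed.

Lemma Im_continuous : continuous (@complex.Im R).
Proof.
move=> z; apply/continuousCP => e e0; exists e => // w.
by apply/le_lt_trans; have := Im_le_normc (w - z); case: w z => ? ? [].
Qed.

Lemma normc_le_ReIm z : normc z <= `|complex.Re z| + `|complex.Im z|.
Proof.
rewrite -ler_sqr ?nnegrE ?addr_ge0 ?normc_ge0 ?normr_ge0// normc_sqr sqrrD.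
by rewrite !real_normK ?num_real// lerD2r lerDl mulrn_wge0 ?mulr_ge0.
Qed.

Lemma Complex_continuous (T : topologicalType) (a b : T -> R) (t : T) :
  {for t, continuous a} -> {for t, continuous b} ->
  {for t, continuous (fun x => a x +i* b x)}.
Proof.
move=> ca cb P /nbhsCP[e e0 eP].
have e20 : 0 < e / 2 by rewrite divr_gt0.
have ha : \forall x \near t, `|a t - a x| < e / 2 by move/cvgrPdist_lt: ca; exact.
have hb : \forall x \near t, `|b t - b x| < e / 2 by move/cvgrPdist_lt: cb; exact.
change (nbhs t (fun x => P (a x +i* b x))).
near=> x; apply: eP; apply: le_lt_trans (normc_le_ReIm _) _ => /=.
rewrite [e]splitr; apply: ltrD; rewrite distrC; near: x; assumption.
Unshelve. all: by end_near. Qed.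

Lemma open_disc z r : open [set w | normc (w - z) < r].
Proof.
rewrite openE => w /= wr; apply/nbhsCP; exists (r - normc (w - z)); first by rewrite subr_gt0.
move=> x xw /=; have := normc_triangle x w z; lra.
Qed.
End Plane.

(** * Connectedness *)

Section Connectedness.
Variable T : topologicalType.
Implicit Types A B D E U V : set T.

(** Replaces the clopen-subset definition by splittings into two open sets, which can be transferred
    between a set and its enlargements. *)
Lemma connected_openP A : connected A <->
  (forall U V, open U -> open V -> A `<=` U `|` V -> A `&` U `&` V = set0 ->
     A `&` U !=set0 -> A `<=` U).
Proof.
split=> [cA U V oU oV AUV AUV0 AU|H B B0 [C oC BC] [D cD BD]].
  suff: A `&` U = A by move=> <- x [].
  apply: cA => //; first by exists U.
  exists (~` V); first exact: open_closedC.
  apply/seteqP; split=> x [Ax].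
    by move=> Ux; split=> // Vx; have : set0 x by rewrite -AUV0.
  by move=> Vx; split=> //; have [] := AUV _ Ax.
suff sAC : A `<=` C by rewrite BC; apply/seteqP; split=> [x []|x Ax] //; split=> //; exact: sAC.
apply: (H C (~` D)) => //.
- exact: closed_openC.
- move=> x Ax; have [Dx|Dx] := pselect (D x); last by right.
  by left; have : B x; [rewrite BD|rewrite BC => -[]].
- by rewrite -BC BD -setIA setICr setI0.
- by rewrite -BC.
Qed.

(** Used to punch a hole: D is a disc around a mass, and the part of the domain in D is a connected
    collar. *)
Lemma connected_removal E D : open E -> open D -> connected (E `|` D) ->
  connected (E `&` D) -> E `&` D !=set0 -> connected E.
Proof.
move=> oE oD cED /connected_openP cI [d [Ed Dd]]; apply/connected_openP.
(* The side U containing [E `&` D] absorbs D, and then [E `|` D] is split by [U `|` D] and V. *)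
have key U V : open U -> open V -> E `<=` U `|` V -> E `&` U `&` V = set0 ->
    E `&` D `<=` U -> E `<=` U.
  move=> oU oV EUV UV0 EDU x Ex; apply: contrapT => Ux.
  have Vx : V x by case: (EUV _ Ex).
  have /connected_openP/(_ (E `&` U `|` D) (E `&` V)) H := cED.
  suff [[_ //]|Dx] : (E `&` U `|` D) x by exact: Ux (EDU _ _).
  apply: H; last by left.
  - by apply: openU => //; exact: openI.
  - exact: openI.
  - move=> y [Ey|Dy]; last by left; right.
    by case: (EUV _ Ey) => ?; [left; left|right].
  - apply/seteqP; split=> // y [[_ [[Ey Uy]|Dy]] [Ey' Vy]]; rewrite -UV0; split=> //.
    by split=> //; apply: EDU.
  - by exists d; split; right.
move=> U V oU oV EUV UV0 [x [Ex Ux]].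
have [dU|dU] := pselect (U d).
  apply: (key U V) => //; apply: (cI U V) => //.
  - by move=> y [/EUV].
  - by apply/seteqP; split=> // y [[[Ey _] Uy] Vy]; rewrite -UV0.
  - by exists d.
have VU0 : E `&` V `&` U = set0 by rewrite -setIA (setIC V) setIA.
have EV : E `<=` V.
  apply: (key V U) => //; first by rewrite setUC.
  apply: (cI V U) => //; rewrite ?(setUC V) //.
  - by move=> y [/EUV].
  - by apply/seteqP; split=> // y [[[Ey _] Uy] Vy]; rewrite -UV0.
  - by exists d; split=> //; case: (EUV _ Ed).
by have : set0 x by rewrite -UV0; split=> //; exact: EV.
Qed.

(** The component of x is covered by the disjoint open sets [U i] and the union of the others, so it
    cannot leave [U i]. *)
Lemma connected_component_open_piece A (I : Type) (U : I -> set T) i x :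
  (forall j, open (U j)) -> A `<=` \bigcup_j U j ->
  (forall j k y, U j y -> U k y -> j = k) ->
  connected (A `&` U i) -> (A `&` U i) x -> connected_component A x = A `&` U i.
Proof.
move=> oU AU dU cAi Aix; apply/seteqP; split; last first.
  by apply: connected_component_max => // y [].
move=> y Cy; split; first exact: connected_component_sub Cy.
have /connected_openP/(_ (U i) (\bigcup_(j in [set j | j <> i]) U j)) := @component_connected _ A x.
apply; last exact: Cy.
- exact: oU.
- by apply: bigcup_open => j _; exact: oU.
- move=> z /connected_component_sub/AU[j _ Ujz].
  have [ji|ji] := pselect (j = i); first by left; rewrite -ji.
  by right; exists j.
- apply/seteqP; split=> // z [[_ Uiz] [j ji Ujz]]; exact: ji (dU _ _ _ Ujz Uiz).
- exists x; split; last by case: Aix.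
  by apply: connected_component_refl; case: Aix.
Qed.

Lemma card_components A n (U : 'I_n -> set T) :
  (forall j, open (U j)) -> A `<=` \bigcup_j U j ->
  (forall j k y, U j y -> U k y -> j = k) ->
  (forall j, connected (A `&` U j)) -> (forall j, A `&` U j !=set0) ->
  (connected_component A @` A #= `I_n)%card.
Proof.
move=> oU AU dU cU nU.
have -> : connected_component A @` A = (fun j => A `&` U j) @` [set: 'I_n].
  apply/seteqP; split=> [C [x Ax <-]|_ [j _ <-]].
    have [j _ Ujx] := AU _ Ax; exists j => //.
    by rewrite (connected_component_open_piece (i:=j) (U:=U)).
  have [x Ajx] := nU j; exists x; first by case: Ajx.
  by rewrite (connected_component_open_piece (i:=j) (U:=U)).
rewrite (card_eql (inj_card_eq _)); first by rewrite card_eq_sym card_II.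
move=> j k _ _ jk; have [x Ajx] := nU j.
by have [_ Ukx] : (A `&` U k) x by [rewrite -jk]; apply: (dU _ _ x) => //; case: Ajx.
Qed.
End Connectedness.

(** * Level sets of radially monotone functions *)

Section Radial.
Variable R : realType.

Definition polar (s : R[i]) (r t : R) : R[i] := s + ((r * cos t) +i* (r * sin t)).

Lemma normc_polar s r t : 0 <= r -> normc (polar s r t - s) = r.
Proof.
move=> r0; rewrite /polar addrAC subrr add0r /= !exprMn -mulrDr cos2Dsin2 mulr1.
by rewrite sqrtr_sqr ger0_norm.
Qed.

Lemma polar_dist s r r' t : normc (polar s r t - polar s r' t) = `|r - r'|.
Proof.
rewrite /polar opprD addrACA subrr add0r /= -!mulrBl !exprMn -mulrDr cos2Dsin2 mulr1.
by rewrite sqrtr_sqr.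
Qed.

Lemma polarP s z : exists t, z = polar s (normc (z - s)) t.
Proof.
have [->|zs] := eqVneq z s.
  by exists 0; rewrite subrr normc0 /polar !mul0r addr0.
have r0 : 0 < normc (z - s) by rewrite normc_gt0 subr_eq0.
set r := normc _ in r0 *.
suff [t [ct st]] : exists t, complex.Re (z - s) = r * cos t /\ complex.Im (z - s) = r * sin t.
  by exists t; rewrite /polar -ct -st; move: (z) (s) => [? ?] [? ?] /=; congr Complex; ring.
have := normc_sqr (z - s); rewrite -/r.
set x := complex.Re _; set y := complex.Im _ => rxy.
have r_neq0 : r != 0 by rewrite gt_eqF.
have x1 : (x / r) ^+ 2 + (y / r) ^+ 2 = 1.
  by rewrite !expr_div_n -mulrDl -rxy divff// expf_neq0.
have xr1 : -1 <= x / r <= 1.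
  by have := sqr_ge0 (y / r); move: x1; set a := x / r; set b := y / r => *; apply/andP; split; nra.
have yr : Num.sqrt (1 - (x / r) ^+ 2) = `|y / r|.
  by rewrite -x1 addrC addKr sqrtr_sqr.
(* [acos] yields angles with nonnegative sine only; the lower half plane takes the opposite
   angle. *)
have [y0|y0] := leP 0 (y / r).
  exists (acos (x / r)); rewrite acosK ?in_itv//= sin_acos// yr ger0_norm//.
  by rewrite ![r * _]mulrC !divfK.
exists (- acos (x / r)); rewrite cosN sinN acosK ?in_itv//= sin_acos// yr ltr0_norm// opprK.
by rewrite ![r * _]mulrC !divfK.
Qed.

Lemma polar_continuous_angle s (r : R -> R) : continuous r ->
  continuous (fun t => polar s (r t) t).
Proof.
move=> cr t; rewrite /polar.
have -> : (fun t => s + (r t * cos t +i* (r t * sin t))) =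
    (fun t => (complex.Re s + r t * cos t) +i* (complex.Im s + r t * sin t)).
  by apply/funext => u; case: s.
apply: (@Complex_continuous R R (fun t => complex.Re s + r t * cos t)
  (fun t => complex.Im s + r t * sin t)); apply: continuousD; try exact: cst_continuous.
  by apply: continuousM; [exact: cr|exact: continuous_cos].
by apply: continuousM; [exact: cr|exact: continuous_sin].
Qed.

Lemma polar_continuous_radius s t : continuous (fun r => polar s r t).
Proof.
move=> r; rewrite /polar.
have -> : (fun r => s + (r * cos t +i* (r * sin t))) =
    (fun r => (complex.Re s + r * cos t) +i* (complex.Im s + r * sin t)).
  by apply/funext => u; case: s.
apply: (@Complex_continuous R R (fun r => complex.Re s + r * cos t)
  (fun r => complex.Im s + r * sin t)); apply: continuousD; try exact: cst_continuous;
 by apply: continuousM; [by []|exact: cst_continuous].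
Qed.

(* An implicit function theorem without differentiability: strict monotonicity
   in the second variable makes the solution continuous in the first one. *)
Lemma monotone_implicit (T : topologicalType) (f : T -> R -> R) (lo hi c : R) :
  lo < hi ->
  (forall t, {in `[lo, hi] &, {homo f t : x y / x < y}}) ->
  (forall t, f t lo < c < f t hi) ->
  (forall t, {in `[lo, hi], continuous (f t)}) ->
  (forall r, lo <= r <= hi -> continuous (f ^~ r)) ->
  exists rho : T -> R, [/\ continuous rho, forall t, lo < rho t < hi &
    forall t r, lo <= r <= hi -> (f t r < c) = (r < rho t) /\ (f t r > c) = (r > rho t)].
Proof.
move=> lohi mono fc cf cr.
have /choice[rho rhoP] : forall t, exists r, lo < r < hi /\ f t r = c.
  move=> t; have /andP[l h] := fc t.
  have [|r] := @IVT _ (f t) lo hi c (ltW lohi) (continuous_subspace_itv (cf t)).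
    by rewrite ge_min le_max (ltW l) (ltW h) orbT.
  rewrite in_itv/= => /andP[lr rh] frc; exists r; split=> //.
  by rewrite !lt_neqAle lr rh !andbT; apply/andP; split; apply/eqP => e; [move: l|move: h];
    rewrite ?e ?frc -?e ?frc ltxx.
have cmp t r : lo <= r <= hi -> (f t r < c) = (r < rho t) /\ (f t r > c) = (r > rho t).
  move=> rlh; have [/andP[lr rh] frc] := rhoP t.
  have rin : r \in `[lo, hi] by rewrite in_itv.
  have rhoin : rho t \in `[lo, hi] by rewrite in_itv/= !ltW.
  rewrite -frc; have [rr|rr|->] := ltgtP r (rho t); last by rewrite !ltxx.
    by have h := mono t _ _ rin rhoin rr; rewrite h (lt_gtF h).
  by have h := mono t _ _ rhoin rin rr; rewrite h (lt_gtF h).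
exists rho; split=> //; last by move=> t; case: (rhoP t).
move=> t0; apply/cvgrPdist_lt => e e0.
have [/andP[lr rh] frc] := rhoP t0.
(* Small enough that [rho t0 - d] and [rho t0 + d] stay in the interval. The strict inequalities
   there persist for t near [t0] and trap [rho t] between them. *)
pose d := Num.min (e / 2) (Num.min ((rho t0 - lo) / 2) ((hi - rho t0) / 2)).
have d0 : 0 < d by rewrite !lt_min !divr_gt0 ?subr_gt0.
have [de dl dh] : [/\ d <= e / 2, d <= (rho t0 - lo) / 2 & d <= (hi - rho t0) / 2].
  by rewrite /d !ge_min !lexx !orbT.
have alh : lo <= rho t0 - d <= hi by apply/andP; split; lra.
have blh : lo <= rho t0 + d <= hi by apply/andP; split; lra.
have fa : f t0 (rho t0 - d) < c by rewrite (cmp _ _ alh).1; lra.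
have fb : c < f t0 (rho t0 + d) by rewrite (cmp _ _ blh).2; lra.
have na : \forall t \near t0, f t (rho t0 - d) < c := cr _ alh t0 _ (lt_nbhsl fa).
have nb : \forall t \near t0, c < f t (rho t0 + d) := cr _ blh t0 _ (lt_nbhsr fb).
near=> t.
have : f t (rho t0 - d) < c by near: t.
have : c < f t (rho t0 + d) by near: t.
rewrite (cmp _ _ alh).1 (cmp _ _ blh).2 ltr_norml => h1 h2.
by apply/andP; split; lra.
Unshelve. all: by end_near. Qed.

Definition annulus (s : R[i]) (lo hi : R) := [set z | lo <= normc (z - s) <= hi].

Section Annulus.
Context (f : R[i] -> R) (s : R[i]) (lo hi c : R).
Hypotheses (lo0 : 0 < lo) (lohi : lo < hi).
Hypothesis mono : forall t, {in `[lo, hi] &, {homo (fun r => f (polar s r t)) : x y / x < y}}.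
Hypothesis low : forall z, normc (z - s) = lo -> f z < c.
Hypothesis high : forall z, normc (z - s) = hi -> c < f z.
Hypothesis cf : forall z, annulus s lo hi z -> {for z, continuous f}.

Lemma annulus_polar r t : lo <= r <= hi -> annulus s lo hi (polar s r t).
Proof.
by move=> rlh; rewrite /annulus/= normc_polar//; case/andP: rlh => lr _; exact/ltW/(lt_le_trans lo0).
Qed.

Lemma annulus_profile : exists rho : R -> R, [/\ continuous rho, forall t, lo < rho t < hi &
    forall t r, lo <= r <= hi -> (f (polar s r t) < c) = (r < rho t) /\
      (f (polar s r t) > c) = (r > rho t)].
Proof.
have lo_ge0 := ltW lo0; have hi_ge0 := ltW (lt_trans lo0 lohi).
apply: (@monotone_implicit R (fun t r => f (polar s r t))) => //.
- by move=> t; rewrite low ?high ?normc_polar.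
- move=> t r; rewrite in_itv/= => rlh.
  apply: (@continuous_comp _ _ _ (fun r => polar s r t) f).
    exact: polar_continuous_radius.
  exact/cf/annulus_polar.
- move=> r rlh t; apply: (@continuous_comp _ _ _ (fun t => polar s r t) f).
    apply: (@polar_continuous_angle s (fun=> r)); exact: cst_continuous.
  exact/cf/annulus_polar.
Qed.

Lemma connected_range (g : R -> R[i]) : continuous g -> connected (range g).
Proof.
move=> cg; apply: connected_continuous_connected; last exact: continuous_subspaceT.
by apply/connected_intervalP.
Qed.

(** Each ray meets the level set exactly once, at radius [rho t], so the level set is a continuous
    image of the line of angles. *)
Lemma annulus_level_connected : connected (annulus s lo hi `&` [set z | f z = c]).
Proof.
have l0 := lo0.
have [rho [crho rholh rhoP]] := annulus_profile.
suff -> : annulus s lo hi `&` [set z | f z = c] = range (fun t => polar s (rho t) t).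
  by apply: connected_range; exact: polar_continuous_angle.
apply/seteqP; split=> [z [za /= fz]|_ [t _ <-]].
  have [t zt] := polarP s z; exists t => //; rewrite [RHS]zt.
  congr polar; have [] := rhoP t _ za; rewrite -zt fz ltxx; case: ltgtP => //.
have /andP[l h] := rholh t.
have lh : lo <= rho t <= hi by rewrite !ltW.
split; first exact: annulus_polar.
have [/=] := rhoP t _ lh; rewrite ltxx; case: ltgtP => //.
Qed.

Lemma annulus_level_nonempty : annulus s lo hi `&` [set z | f z = c] !=set0.
Proof.
have l0 := lo0.
have [rho [crho rholh rhoP]] := annulus_profile.
exists (polar s (rho 0) 0); have /andP[l h] := rholh 0.
have lh : lo <= rho 0 <= hi by rewrite !ltW.
split; first exact: annulus_polar.
have [/=] := rhoP 0 _ lh; rewrite ltxx; case: ltgtP => //.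
Qed.

Lemma annulus_superlevel_connected :
  connected [set z | lo <= normc (z - s) < hi /\ c < f z].
Proof.
have l0 := lo0.
have [rho [crho rholh rhoP]] := annulus_profile.
(* The curve halfway between the level curve and the outer circle crosses every radial segment of
   the superlevel set. Each [A t] is this whole curve with one segment attached, so all of them
   share a point. *)
pose k t := polar s ((rho t + hi) / 2) t.
pose A t := range k `|` (polar s ^~ t) @` `]rho t, hi[.
have -> : [set z | lo <= normc (z - s) < hi /\ c < f z] = \bigcup_(t in setT) A t.
  apply/seteqP; split=> [z [/= /andP[lz hz] fz]|z [t _ [[u _ <-]|[r /= rI <-]]]].
  - have [t zt] := polarP s z; exists t => //; right; exists (normc (z - s)) => //=.
    have lh : lo <= normc (z - s) <= hi by rewrite lz ltW.
    have [_] := rhoP t _ lh.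
    by rewrite -zt fz in_itv/= hz andbT.
  - have /andP[l h] := rholh u; rewrite /k /=.
    have h1 : lo <= (rho u + hi) / 2 <= hi by apply/andP; split; lra.
    rewrite normc_polar; last by lra.
    by rewrite (rhoP _ _ h1).2; split; first (apply/andP; split); lra.
  - move: rI; rewrite in_itv/= => /andP[r1 r2]; have /andP[l h] := rholh t.
    have h1 : lo <= r <= hi by apply/andP; split; lra.
    rewrite normc_polar; last by lra.
    by rewrite (rhoP _ _ h1).2; split=> //; apply/andP; split; lra.
apply: bigcup_connected.
  by exists (k 0) => t _; left; exists 0.
move=> t _; apply: connectedU.
- exists (k t); split; first by exists t.
  exists ((rho t + hi) / 2) => //=; rewrite in_itv/=; have /andP[l h] := rholh t.
  by apply/andP; split; lra.
- apply: connected_range; apply: polar_continuous_angle => u.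
  apply: (@continuousM _ _ (fun u => rho u + hi) (fun=> 2^-1)); last exact: cst_continuous.
  by apply: continuousD; [exact: crho|exact: cst_continuous].
- apply: connected_continuous_connected.
    by apply/connected_intervalP; exact: interval_is_interval.
  by apply: continuous_subspaceT; exact: polar_continuous_radius.
Qed.

(** A level point is a limit of superlevel points because f increases when the point is pushed
    outwards along its ray. This makes level points true boundary points. *)
Lemma annulus_level_closure z : annulus s lo hi z -> f z = c ->
  closure [set w | lo <= normc (w - s) < hi /\ c < f w] z.
Proof.
have l0 := lo0.
have [rho [crho rholh rhoP]] := annulus_profile.
move=> za fz P /nbhsCP[e e0 eP].
have [t zt] := polarP s z.
have rz : normc (z - s) = rho t.
  have [] := rhoP t _ za; rewrite -zt fz ltxx; case: ltgtP => //.
have /andP[l h] := rholh t.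
pose d := Num.min (e / 2) ((hi - rho t) / 2).
have d0 : 0 < d by rewrite !lt_min !divr_gt0 ?subr_gt0.
have [de dh] : d <= e / 2 /\ d <= (hi - rho t) / 2.
  by rewrite /d !ge_min !lexx !orbT.
have h1 : lo <= rho t + d <= hi by apply/andP; split; lra.
exists (polar s (rho t + d) t); split; last first.
  apply: eP; rewrite [in X in _ - X]zt polar_dist rz addrAC subrr add0r gtr0_norm//; lra.
rewrite /= (rhoP _ _ h1).2 normc_polar; last by lra.
by split; first (apply/andP; split); lra.
Qed.
End Annulus.
End Radial.

(** * Logarithmic potentials *)

Section Potential.
Variable R : realType.
Implicit Types (S : seq R[i]) (c : R[i] -> R) (z w : R[i]).

Lemma ln_sub_le (x y : R) : 0 < x -> 0 < y -> ln x - ln y <= (x - y) / y.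
Proof.
move=> x0 y0; rewrite -ln_div ?posrE//.
have -> : x / y = 1 + (x - y) / y by field; rewrite gt_eqF.
by apply: le_ln1Dx; rewrite mulrBl divff ?gt_eqF// ltrBDr addrC subrr divr_gt0.
Qed.

Lemma ln_dist_le (d x y : R) : 0 < d -> d <= x -> d <= y -> `|ln x - ln y| <= `|x - y| / d.
Proof.
move=> d0; have key a b : d <= a -> d <= b -> ln a - ln b <= `|a - b| / d.
  move=> da db; have [a0 b0] : 0 < a /\ 0 < b by split; apply: lt_le_trans d0 _.
  apply: le_trans (ln_sub_le a0 b0) _; apply: (@le_trans _ _ (`|a - b| / b)).
    by rewrite ler_pM2r ?invr_gt0// ler_norm.
  by rewrite ler_wpM2l// lef_pV2.
move=> dx dy; rewrite ler_norml (key _ _ dx dy) andbT lerNl opprB.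
by rewrite distrC; exact: key.
Qed.

Lemma ln_le_id (x : R) : 0 <= x -> ln x <= x.
Proof.
rewrite le_eqVlt => /predU1P[<-|x0]; first by rewrite ln0.
exact/ltW/ln_sublinear.
Qed.

(** Local radii, one for each mass, are merged into their minimum; the first hypothesis says that a
    radius may be shrunk. *)
Lemma seq_common_radius (T : eqType) (s : seq T) (P : T -> R -> Prop) :
  (forall x d d', P x d -> 0 < d' <= d -> P x d') ->
  (forall x, x \in s -> exists2 d, 0 < d & P x d) ->
  exists2 d, 0 < d & forall x, x \in s -> P x d.
Proof.
move=> mono; elim: s => [|x s IH] H; first by exists 1.
have [d d0 dP] : exists2 d, 0 < d & forall x, x \in s -> P x d.
  by apply: IH => y ys; apply: H; rewrite inE ys orbT.
have [e e0 eP] := H x (mem_head _ _).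
exists (Num.min d e); first by rewrite lt_min d0.
move=> y; rewrite inE => /predU1P[->|ys].
  by apply: mono eP _; rewrite lt_min d0 e0 ge_min lexx orbT.
by apply: mono (dP _ ys) _; rewrite lt_min d0 e0 ge_min lexx.
Qed.

Lemma dist_to_poles S z : z \notin S ->
  exists2 d, 0 < d & forall s, s \in S -> d <= normc (z - s).
Proof.
move=> zS; apply: seq_common_radius => [s d d' dz /andP[_ d'd]|s sS]; first exact: le_trans dz.
by exists (normc (z - s)) => //; rewrite normc_gt0 subr_eq0; apply: contraNneq zS => ->.
Qed.

Lemma open_off_poles S : open [set z | z \notin S].
Proof.
rewrite openE => z /= /dist_to_poles[d d0 dS]; apply/nbhsCP; exists d => // w wz.
by apply/negP => /dS; rewrite normcB; lra.
Qed.

Definition log_potential S c z : R := \sum_(s <- S) c s * ln (normc (z - s)).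

Definition lens_potential S c z : R := log_potential S c z - normc z ^+ 2 / 2.

Section Bounds.
Context (S : seq R[i]) (c : R[i] -> R) (c0 : forall s, s \in S -> 0 < c s).

Let K := \sum_(s <- S) c s.

Lemma total_mass_ge0 : 0 <= K.
Proof. by rewrite /K big_seq; apply: sumr_ge0 => s /c0/ltW. Qed.

Lemma log_potential_lipschitz d z w : 0 < d ->
  (forall s, s \in S -> d <= normc (z - s)) -> (forall s, s \in S -> d <= normc (w - s)) ->
  `|log_potential S c z - log_potential S c w| <= K / d * normc (z - w).
Proof.
move=> d0 dz dw; rewrite /log_potential -sumrB /K mulr_suml mulr_suml.
apply: le_trans (ler_norm_sum _ _ _) _; rewrite big_seq [leRHS]big_seq.
apply: ler_sum => s sS; rewrite -mulrBr normrM gtr0_norm ?c0// -mulrA ler_pM2l ?c0//.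
apply: le_trans (ln_dist_le d0 (dz _ sS) (dw _ sS)) _.
rewrite mulrC ler_pM2l ?invr_gt0//; apply: le_trans (normc_dist _ _) _.
by rewrite opprB addrA subrK.
Qed.

Lemma log_potential_ub z M : (forall s, s \in S -> normc s <= M) ->
  log_potential S c z <= K * (normc z + M).
Proof.
move=> SM; rewrite /log_potential /K mulr_suml big_seq [leRHS]big_seq.
apply: ler_sum => s sS; rewrite ler_pM2l ?c0//.
apply: le_trans (ln_le_id (normc_ge0 _)) _; apply: le_trans (le_normcD _ _) _.
by rewrite normcN lerD2l SM.
Qed.

Lemma log_potential_lb z d : 0 < d -> (forall s, s \in S -> d <= normc (z - s)) ->
  K * ln d <= log_potential S c z.
Proof.
move=> d0 Sd; rewrite /log_potential /K mulr_suml big_seq [leRHS]big_seq.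
apply: ler_sum => s sS; rewrite ler_pM2l ?c0// ler_ln ?posrE ?Sd//.
exact: lt_le_trans d0 (Sd _ sS).
Qed.

Lemma log_potential_continuous z : z \notin S -> {for z, continuous (log_potential S c)}.
Proof.
move=> zS; apply/continuousCP => e e0.
have [d d0 dS] := dist_to_poles zS.
have K0 := total_mass_ge0.
have d20 : 0 < d / 2 by rewrite divr_gt0.
exists (Num.min (d / 2) (e / (K / (d / 2) + 1))).
  by rewrite lt_min d20 divr_gt0// ltr_wpDl// divr_ge0// ltW.
move=> w; rewrite lt_min => /andP[w1 w2].
apply: (@le_lt_trans _ _ (K / (d / 2) * normc (w - z))).
  apply: log_potential_lipschitz => // s sS; have := dS _ sS;
  by have := normc_triangle z w s; rewrite (normcB z w); lra.
move: w2; rewrite ltr_pdivlMr; last by rewrite ltr_wpDl// divr_ge0// ltW.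
by have := normc_ge0 (w - z); nra.
Qed.

Lemma lens_potential_continuous z : z \notin S -> {for z, continuous (lens_potential S c)}.
Proof.
move=> zS; apply: continuousB; first exact: log_potential_continuous.
apply: continuousM; last exact: cst_continuous.
apply: (@continuous_comp _ _ _ (@normc R) (fun x => x ^+ 2)); first exact: normc_continuous.
exact: exprn_continuous.
Qed.

Lemma poles_bounded : exists2 M, 0 <= M & forall s, s \in S -> normc s <= M.
Proof.
exists (\sum_(s <- S) normc s); first by apply: sumr_ge0 => s _; exact: normc_ge0.
move=> s sS; rewrite (big_rem s sS)/= lerDl; apply: sumr_ge0 => t _; exact: normc_ge0.
Qed.

Lemma lens_potential_low_near_infinity a : exists2 r, 0 < r &
  forall z, r <= normc z -> lens_potential S c z < a.
Proof.
have [M M0 SM] := poles_bounded; have K0 := total_mass_ge0.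
(* The logarithms are at most K (x + M) at modulus x, and from this radius on x^2 / 2 exceeds K x +
   K M + |a|. *)
exists (4 * K + 2 * (K * M) + 2 * `|a| + 2); first by have := normr_ge0 a; nra.
move=> z zr; have := @log_potential_ub z _ SM; rewrite /lens_potential.
have := ler_norm (- a); rewrite normrN; have := normr_ge0 a.
have KM : 0 <= K * M by exact: mulr_ge0.
move: (`|a|) (normc z) (K * M) zr KM (mulrDr K (normc z) M) => b x KM zr ? -> *.
suff : K * x + KM + b < x ^+ 2 / 2 by lra.
have x2 : 2 <= x by lra.
have : 4 * K * x <= (x - 2 * KM - 2 * b - 2) * x by rewrite ler_wpM2r; lra.
nra.
Qed.

Lemma lens_potential_decreasing_near_infinity : exists2 r, 0 < r &
  forall r1 r2 t, r <= r1 -> r1 < r2 ->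
  lens_potential S c (polar 0 r2 t) < lens_potential S c (polar 0 r1 t).
Proof.
have [M M0 SM] := poles_bounded; have K0 := total_mass_ge0.
(* Beyond this radius all masses are at distance at least 1, so the logarithmic part is K-Lipschitz,
   while x^2 / 2 grows faster than K x. *)
exists (M + K + 1); first by lra.
move=> r1 r2 t rr1 r12; rewrite /lens_potential.
have np r : 0 <= r -> normc (polar 0 r t) = r.
  by move=> r0; rewrite -[RHS](normc_polar 0 t r0) subr0.
have n1 : normc (polar 0 r1 t) = r1 by apply: np; lra.
have n2 : normc (polar 0 r2 t) = r2 by apply: np; lra.
have far z : M + 1 <= normc z -> forall s, s \in S -> 1 <= normc (z - s).
  by move=> zM s sS; have := normc_triangle z s 0; rewrite !subr0; have := SM _ sS; lra.
have H : `|log_potential S c (polar 0 r2 t) - log_potential S c (polar 0 r1 t)| <= K * (r2 - r1).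
  have := @log_potential_lipschitz 1 (polar 0 r2 t) (polar 0 r1 t) ltr01.
  rewrite divr1 polar_dist [`|r2 - r1|]gtr0_norm ?subr_gt0//.
  by apply; apply: far; rewrite ?n1 ?n2; lra.
have := le_trans (ler_norm _) H; rewrite n1 n2.
nra.
Qed.

Lemma lens_potential_split s z : s \in S -> lens_potential S c z =
  c s * ln (normc (z - s)) + log_potential (rem s S) c z - normc z ^+ 2 / 2.
Proof. by move=> sS; rewrite /lens_potential /log_potential (big_rem s sS). Qed.

Lemma lens_potential_low_near_pole s a : s \in S -> exists2 r, 0 < r &
  forall z, 0 < normc (z - s) <= r -> lens_potential S c z < a.
Proof.
move=> sS; have [M M0 SM] := poles_bounded.
have cs0 := c0 sS.
pose K' := \sum_(s <- rem s S) c s.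
have c0' t : t \in rem s S -> 0 < c t by move=> /mem_rem/c0.
have K'0 : 0 <= K' by rewrite /K' big_seq; apply: sumr_ge0 => t /c0'/ltW.
pose B := K' * (normc s + 1 + M).
(* Within distance 1 of s the other logarithms contribute at most B; the exponential makes the
   singular term at most a - B - 1. *)
exists (Num.min 1 (expR ((a - B - 1) / c s))).
  by rewrite lt_min ltr01 expR_gt0.
move=> z /andP[z0]; rewrite le_min => /andP[z1 ze].
have ub : log_potential (rem s S) c z <= B.
  rewrite /log_potential /B /K' mulr_suml big_seq [leRHS]big_seq.
  apply: ler_sum => t tS; rewrite ler_pM2l ?c0'//.
  apply: le_trans (ln_le_id (normc_ge0 _)) _; apply: le_trans (le_normcD _ _) _.
  rewrite normcN lerD ?SM ?(mem_rem tS)//.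
  by have := normc_triangle z s 0; rewrite !subr0; lra.
have : ln (normc (z - s)) <= (a - B - 1) / c s.
  by rewrite -[leRHS]expRK ler_ln ?posrE ?expR_gt0.
rewrite ler_pdivlMr// mulrC => lnz.
by rewrite (lens_potential_split _ sS); have := sqr_ge0 (normc z); lra.
Qed.

(** From radius r1 to r2 the singular term gains at least c_s (r2 - r1) / r2, which for small r2
    beats any Lipschitz bound on the remaining terms. *)
Lemma lens_potential_increasing_near_pole s : uniq S -> s \in S -> exists2 d, 0 < d &
  forall r1 r2 t, 0 < r1 -> r1 < r2 -> r2 <= d ->
  lens_potential S c (polar s r1 t) < lens_potential S c (polar s r2 t).
Proof.
move=> uS sS; have cs0 := c0 sS.
pose K' := \sum_(s <- rem s S) c s.
have c0' t : t \in rem s S -> 0 < c t by move=> /mem_rem/c0.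
have K'0 : 0 <= K' by rewrite /K' big_seq; apply: sumr_ge0 => t /c0'/ltW.
have [D D0 DP] : exists2 D, 0 < D & forall t, t \in rem s S -> D <= normc (s - t).
  apply: seq_common_radius => [t d d' dz /andP[_ d'd]|t]; first exact: le_trans dz.
  rewrite mem_rem_uniq// !inE => /andP[ts tS].
  by exists (normc (s - t)) => //; rewrite normc_gt0 subr_eq0 eq_sym.
have D20 : 0 < D / 2 by rewrite divr_gt0.
(* A Lipschitz constant for the rest: the other logarithms at distance at least D / 2 from their
   poles, plus |z|^2 / 2 where |z| <= |s| + 1. *)
pose L := K' / (D / 2) + normc s + 1.
have L0 : 0 < L by rewrite /L ltr_wpDl// addr_ge0 ?normc_ge0// divr_ge0// ltW.
exists (Num.min (D / 2) (Num.min 1 (c s / (L + 1)))).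
  by rewrite !lt_min D20 ltr01/= divr_gt0// ltr_wpDl// ltW.
move=> r1 r2 t r10 r12; rewrite !le_min => /and3P[rD r21 rc].
have r20 := lt_trans r10 r12.
rewrite !(lens_potential_split _ sS) !normc_polar ?ltW//.
set z1 := polar s r1 t; set z2 := polar s r2 t.
have far r u : 0 <= r -> r <= D / 2 -> u \in rem s S -> D / 2 <= normc (polar s r t - u).
  move=> r0 rD2 uS'; have := normc_triangle s (polar s r t) u.
  by rewrite (normcB s (polar s r t)) normc_polar//; have := DP _ uS'; lra.
have lip : `|log_potential (rem s S) c z1 - log_potential (rem s S) c z2| <= K' / (D / 2) * (r2 - r1).
  rewrite /log_potential -sumrB /K' mulr_suml mulr_suml.
  apply: le_trans (ler_norm_sum _ _ _) _; rewrite big_seq [leRHS]big_seq.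
  apply: ler_sum => u uS'; rewrite -mulrBr normrM gtr0_norm ?c0'// -mulrA ler_pM2l ?c0'//.
  have f1 : D / 2 <= normc (z1 - u) by apply: far => //; lra.
  have f2 : D / 2 <= normc (z2 - u) by apply: far => //; lra.
  apply: le_trans (ln_dist_le D20 f1 f2) _.
  rewrite mulrC ler_pM2l ?invr_gt0//; apply: le_trans (normc_dist _ _) _.
  by rewrite opprB addrA subrK polar_dist distrC gtr0_norm ?subr_gt0.
have lip2 : normc z2 ^+ 2 - normc z1 ^+ 2 <= (r2 - r1) * (2 * (normc s + 1)).
  have n1 : normc z1 <= normc s + 1.
    have := normc_triangle z1 s 0; rewrite !subr0 /z1 normc_polar ?(ltW r10)//; lra.
  have n2 : normc z2 <= normc s + 1.
    have := normc_triangle z2 s 0; rewrite !subr0 /z2 normc_polar ?(ltW r20)//; lra.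
  rewrite subr_sqr; apply: (@le_trans _ _ ((r2 - r1) * (normc z2 + normc z1))).
    rewrite ler_wpM2r ?addr_ge0 ?normc_ge0//.
    apply: le_trans (ler_norm _) _; apply: le_trans (normc_dist _ _) _.
    by rewrite polar_dist gtr0_norm ?subr_gt0.
  by rewrite ler_pM2l ?subr_gt0//; lra.
have lnr : (r2 - r1) / r2 <= ln r2 - ln r1.
  by rewrite -(opprB r1) mulNr; have := ln_sub_le r10 r20; lra.
have rcL : r2 * (L + 1) <= c s by rewrite -ler_pdivlMr// ltr_wpDl// ltW.
have : c s * (ln r2 - ln r1) >= (L + 1) * (r2 - r1).
  apply: (@le_trans _ _ (c s * ((r2 - r1) / r2))); last by rewrite ler_pM2l.
  rewrite mulrA ler_pdivlMr//; have := subr_gt0 r1 r2; rewrite r12; nra.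
have := ler_norm (log_potential (rem s S) c z1 - log_potential (rem s S) c z2).
move: lip lip2; rewrite /L; have := subr_gt0 r1 r2; rewrite r12.
move: (K' / (D / 2)) (normc s) => k m; nra.
Qed.

End Bounds.
End Potential.

(** * The domain and its boundary components *)

Section SuperlevelDomain.
Variable R : realType.
Context (S : seq R[i]) (V : R[i] -> R) (a d lo r1 r2 : R).

(* As [ln 0 = 0], the potentials used for V are finite at the poles, hence [z \notin S]. *)
Definition superlevel : set R[i] := [set z | z \notin S /\ a < V z].

(** The hypotheses confine the level set to the annuli [lo] to d around the masses and [r1] to [r2]
    around 0: V is below the level further in and further out, and above it in between. On these
    annuli V is radially monotone. *)
Hypotheses (uS : uniq S) (lo0 : 0 < lo) (lod : lo < d) (r12 : r1 < r2).
Hypothesis cV : forall z, z \notin S -> {for z, continuous V}.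
Hypothesis sep : {in S &, forall s t, s != t -> 2 * d <= normc (s - t)}.
Hypothesis inside : {in S, forall s, normc s + d < r1}.
Hypothesis pole_mono : {in S, forall s x y t, 0 < x -> x < y -> y <= d ->
  V (polar s x t) < V (polar s y t)}.
Hypothesis pole_low : {in S, forall s z, 0 < normc (z - s) <= lo -> V z < a}.
Hypothesis mid_high : forall z, normc z <= r1 -> {in S, forall s, d <= normc (z - s)} -> a < V z.
Hypothesis out_mono : forall x y t, r1 <= x -> x < y -> V (polar 0 y t) < V (polar 0 x t).
Hypothesis out_low : forall z, r2 <= normc z -> V z < a.
Hypothesis r10 : 0 < r1.

Let disc s : set R[i] := [set z | normc (z - s) < d].

Lemma disc_off_other_poles s t z : s \in S -> t \in S -> s != t -> normc (z - s) <= d ->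
  d <= normc (z - t).
Proof.
move=> sS tS st zs; have := sep sS tS st; have := normc_triangle s z t.
by rewrite (normcB s z); lra.
Qed.

Lemma disc_inside s z : s \in S -> normc (z - s) <= d -> normc z < r1.
Proof.
move=> sS zs; have := inside sS; have := normc_triangle z s 0.
by rewrite !subr0; lra.
Qed.

Lemma punctured_disc_off_poles s z : s \in S -> 0 < normc (z - s) <= d -> z \notin S.
Proof.
move=> sS /andP[z0 zd]; have d0 := lt_trans lo0 lod; apply/negP => zS.
have [sz|sz] := eqVneq s z; first by move: z0; rewrite sz subrr normc0 ltxx.
by have := disc_off_other_poles sS zS sz zd; rewrite subrr normc0; lra.
Qed.

Lemma outside_off_poles z : r1 <= normc z -> z \notin S.
Proof.
move=> z1; apply/negP => /inside; have l0 := lo0; have := lod; lra.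
Qed.

Lemma disc_disjoint s t z : s \in S -> t \in S -> disc s z -> disc t z -> s = t.
Proof.
move=> sS tS; rewrite /disc /= => zs zt; apply/eqP; apply: contraLR zt => st.
by rewrite -leNgt; apply: disc_off_other_poles st _ => //; exact: ltW.
Qed.

Lemma pole_annulus_cont s z : s \in S -> annulus s lo d z -> {for z, continuous V}.
Proof.
move=> sS /andP[zl zd]; apply: cV; apply: (punctured_disc_off_poles sS).
by rewrite zd andbT (lt_le_trans lo0).
Qed.

Lemma pole_circle_high s z : s \in S -> normc (z - s) = d -> a < V z.
Proof.
move=> sS zd; apply: mid_high; first by apply/ltW/(disc_inside sS); rewrite zd.
move=> t tS; have [->|ts] := eqVneq t s; first by rewrite zd.
by apply: (disc_off_other_poles sS tS); rewrite 1?eq_sym ?zd.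
Qed.

Lemma pole_circle_low s z : s \in S -> normc (z - s) = lo -> V z < a.
Proof. by move=> sS zs; apply: (pole_low sS); rewrite zs lo0 lexx. Qed.

Lemma pole_annulus_mono s t : s \in S ->
  {in `[lo, d] &, {homo (fun r => V (polar s r t)) : x y / x < y}}.
Proof.
move=> sS x y; rewrite !in_itv/= => /andP[lx _] /andP[_ yd] xy.
by apply: pole_mono => //; exact: lt_le_trans lx.
Qed.

Lemma open_superlevel : open superlevel.
Proof.
rewrite openE => z [zS az].
have nz : \forall w \near z, w \notin S.
  by apply: open_nbhs_nbhs; split=> //; exact: open_off_poles.
have va : \forall w \near z, a < V w := cV zS (lt_nbhsr az).
by apply: filterS2 nz va => w.
Qed.

Lemma superlevel_disc s : s \in S ->
  superlevel `&` disc s = [set z | lo <= normc (z - s) < d /\ a < V z].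
Proof.
move=> sS; apply/seteqP; split=> z /=.
  move=> [[zS az] zd]; split=> //; rewrite zd andbT leNgt; apply/negP => zl.
  suff /(pole_low sS) : 0 < normc (z - s) <= lo by lra.
  by rewrite ltW// andbT normc_gt0 subr_eq0; apply: contraNneq zS => ->.
move=> [/andP[zl zd] az]; split=> //; split=> //; apply: (punctured_disc_off_poles sS).
by rewrite (lt_le_trans lo0)//= ltW.
Qed.

Lemma superlevel_mem z : normc z <= r1 -> (forall s, s \in S -> ~ disc s z) -> superlevel z.
Proof.
move=> z1 zd; have far : {in S, forall s, d <= normc (z - s)}.
  by move=> s /zd /=; rewrite /disc /= => /negP; rewrite -leNgt.
split; last exact: mid_high.
apply/negP => /far; rewrite subrr normc0; have := lt_trans lo0 lod; lra.
Qed.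

(** The filled set is star-shaped about 0: it contains the whole disc of radius [r1], and beyond
    that radius moving towards 0 only increases V. *)
Lemma superlevel_discs_connected :
  connected (superlevel `|` \bigcup_(s in [set` S]) disc s).
Proof.
set U := _ `|` _.
pose seg z := (fun x : R => x%:C * z) @` `[0, 1].
have U0 : U 0.
  have [[s sS]|h] := pselect (exists2 s, s \in S & disc s 0); first by right; exists s.
  left; apply: superlevel_mem => [|s sS sd]; first by rewrite normc0 ltW.
  by apply: h; exists s.
have cseg z : continuous (fun x : R => x%:C * z).
  have -> : (fun x : R => x%:C * z) = (fun x => (x * complex.Re z) +i* (x * complex.Im z)).
    by apply/funext => x; case: z => p q; simpc.
  move=> x; apply: (@Complex_continuous R R (fun x => x * complex.Re z) (fun x => x * complex.Im z));
  by apply: continuousM; [by []|exact: cst_continuous].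
have -> : U = \bigcup_(z in U) seg z.
  apply/seteqP; split=> [z Uz|w [z Uz [x]]].
    by exists z => //; exists 1; rewrite ?mul1r//= in_itv/= ler01 lexx.
  rewrite /= in_itv/= => /andP[x0 x1] <-.
  have nx : normc (x%:C * z) = x * normc z by rewrite normcM normcR ger0_norm.
  have [xz|xz] := leP (normc (x%:C * z)) r1.
    have [[s sS]|h] := pselect (exists2 s, s \in S & disc s (x%:C * z)).
      by right; exists s.
    by left; apply: superlevel_mem => // s sS sd; apply: h; exists s.
  have zx : x * normc z <= normc z by rewrite ler_piMl// normc_ge0.
  have xr : r1 < x * normc z by rewrite -nx.
  case: Uz => [[zS az]|[s sS sz]]; last first.
    by have := disc_inside sS (ltW sz); lra.
  left; split; first by apply: outside_off_poles; exact: ltW.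
  move: zx; rewrite le_eqVlt => /predU1P[xe|zx].
    have -> : x = 1.
      apply: (@mulIf _ (normc z)); last by rewrite mul1r.
      by rewrite gt_eqF//; move: xr; rewrite xe; apply: lt_trans r10.
    by rewrite mul1r.
  have [t zt] := polarP 0 z.
  have zt' : x%:C * z = polar 0 (x * normc z) t.
    by rewrite {1}zt subr0 /polar !add0r; simpc; rewrite !mulrA.
  by rewrite zt'; apply: lt_trans az _; rewrite {1}zt subr0; apply: out_mono => //; exact: ltW.
apply: bigcup_connected.
  exists 0 => z Uz; exists 0; rewrite ?mul0r//=.
  by rewrite in_itv/= lexx ler01.
move=> z _; apply: connected_continuous_connected; last exact: continuous_subspaceT.
by apply/connected_intervalP; exact: interval_is_interval.
Qed.

(** Induction on the list T of discs that are still filled, starting from the star-shaped set;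
    [connected_removal] opens one disc at each step. *)
Lemma superlevel_connected : connected superlevel.
Proof.
suff H T : uniq T -> {subset T <= S} ->
    connected (superlevel `|` \bigcup_(s in [set` T]) disc s) -> connected superlevel.
  exact: H superlevel_discs_connected.
elim: T => [|s T IH] /=.
  by move=> _ _; rewrite set_nil bigcup_set0 setU0.
move=> /andP[sT uT] TS cT; apply: IH => // [t tT|]; first by apply: TS; rewrite inE tT orbT.
have sS : s \in S by apply: TS; rewrite mem_head.
have odisc t : open (disc t) by exact: open_disc.
(* The other discs are disjoint from this one, so the overlap is just the collar between the level
   curve and the circle of radius d. *)
have ED : (superlevel `|` \bigcup_(t in [set` T]) disc t) `&` disc s =
    [set z | lo <= normc (z - s) < d /\ a < V z].
  rewrite -superlevel_disc//; apply/seteqP; split=> z [Ez sz]; last by split=> //; left.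
  split=> //; case: Ez => // -[t tT tz].
  have tS : t \in S by apply: TS; rewrite inE tT orbT.
  by move: sT; rewrite (disc_disjoint sS tS sz tz) (tT : t \in T).
apply: (@connected_removal _ _ (disc s)).
- by apply: openU; [exact: open_superlevel|exact: bigcup_open].
- exact: odisc.
- rewrite -setUA; suff -> : \bigcup_(t in [set` T]) disc t `|` disc s =
     \bigcup_(t in [set` s :: T]) disc t by [].
  apply/seteqP; split=> z.
    by move=> [[t tT tz]|sz]; [exists t => //=; rewrite inE (tT : t \in T) orbT|
      exists s => //=; rewrite mem_head].
  by move=> [t /=]; rewrite inE => /predU1P[->|tT] tz; [right|left; exists t].
- rewrite ED; apply: annulus_superlevel_connected => //.
  + by move=> t; exact: pole_annulus_mono.
  + by move=> z; exact: pole_circle_low.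
  + by move=> z; exact: pole_circle_high.
  + by move=> z; exact: pole_annulus_cont.
(* The collar is nonempty because a point of the level curve lies in its closure. *)
- rewrite ED; have [z [za Vz]] : annulus s lo d `&` [set z | V z = a] !=set0.
    apply: annulus_level_nonempty => //.
    + by move=> t; exact: pole_annulus_mono.
    + by move=> z; exact: pole_circle_low.
    + by move=> z; exact: pole_circle_high.
    + by move=> z; exact: pole_annulus_cont.
  have zc : closure [set w | lo <= normc (w - s) < d /\ a < V w] z.
    apply: annulus_level_closure => //.
    + by move=> t; exact: pole_annulus_mono.
    + by move=> z'; exact: pole_circle_low.
    + by move=> z'; exact: pole_circle_high.
    + by move=> z'; exact: pole_annulus_cont.
  by have [w [wP _]] := zc setT filterT; exists w.
Qed.

Lemma superlevel_bounded : bounded_set superlevel.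
Proof.
exists r2%:C; split; first by apply/complex_realP; exists r2.
move=> x xr z [_ az] /=; rewrite normCE; apply: (@le_trans _ _ r2%:C); last exact: ltW.
by rewrite lecR leNgt; apply/negP => /ltW/out_low; lra.
Qed.

(** A mass is not a limit point since V < a on a punctured disc around it. Hence V is continuous at
    every point of the closure. *)
Lemma superlevel_closure z : closure superlevel z -> z \notin S /\ a <= V z.
Proof.
move=> cz; have zS : z \notin S.
  apply/negP => zS; have [|w [[wS aw] wz]] := cz [set w | normc (w - z) < lo].
    by apply/nbhsCP; exists lo.
  suff /(pole_low zS) : 0 < normc (w - z) <= lo by lra.
  by rewrite ltW// andbT normc_gt0 subr_eq0; apply: contraNneq wS => ->.
split=> //; rewrite leNgt; apply/negP => Vz.
have Va : \forall w \near z, V w < a := cV zS (lt_nbhsl Vz).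
by have [w [[_ aw] wa]] := cz _ Va; move: aw; rewrite /= ltNge ltW.
Qed.

Lemma interior_superlevel : interior superlevel = superlevel.
Proof.
apply/seteqP; split; first exact: interior_subset.
by have := open_superlevel; rewrite openE.
Qed.

Lemma superlevel_boundary_sub z : boundary superlevel z -> z \notin S /\ V z = a.
Proof.
move=> [/superlevel_closure[zS az]].
rewrite interior_superlevel => zn; split=> //; apply/eqP.
by rewrite eq_le az andbT leNgt; apply/negP => ?; exact: zn.
Qed.

(** V decreases outwards here, so the annulus lemmas are applied to -V at level -a. *)
Lemma out_annulus_mono t :
  {in `[r1, r2] &, {homo (fun r => - V (polar 0 r t)) : x y / x < y}}.
Proof.
move=> x y; rewrite !in_itv/= => /andP[lx _] _ xy.
by rewrite ltrN2; exact: out_mono.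
Qed.

Lemma out_circle_low z : normc (z - 0) = r1 -> - V z < - a.
Proof.
rewrite subr0 ltrN2 => z1; apply: mid_high => [|s sS]; first by rewrite z1.
have := inside sS; have := normc_triangle z s 0; rewrite !subr0; lra.
Qed.

Lemma out_circle_high z : normc (z - 0) = r2 -> - a < - V z.
Proof. by rewrite subr0 ltrN2 => z1; apply: out_low; rewrite z1. Qed.

Lemma out_annulus_cont z : annulus 0 r1 r2 z -> {for z, continuous (fun z => - V z)}.
Proof.
move=> /andP[+ _]; rewrite subr0 => zl; apply: continuousN.
by apply/cV/outside_off_poles.
Qed.

Lemma superlevel_boundary_disc s : s \in S ->
  boundary superlevel `&` disc s = annulus s lo d `&` [set z | V z = a].
Proof.
move=> sS; apply/seteqP; split=> z.
  move=> [/superlevel_boundary_sub[zS Vz] zs]; split=> //.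
  rewrite /annulus /= (ltW zs) andbT leNgt; apply/negP => zl.
  suff /(pole_low sS) : 0 < normc (z - s) <= lo by rewrite Vz ltxx.
  by rewrite ltW// andbT normc_gt0 subr_eq0; apply: contraNneq zS => ->.
move=> [za /= Vz].
have /andP[zl zd] := za.
split; last first.
  rewrite /disc /= lt_neqAle zd andbT; apply/eqP => /(pole_circle_high sS).
  by rewrite Vz ltxx.
split; last first.
  by rewrite interior_superlevel => -[_]; rewrite /= Vz ltxx.
have : closure [set w | lo <= normc (w - s) < d /\ a < V w] z.
  apply: annulus_level_closure => //.
  + by move=> t; exact: pole_annulus_mono.
  + by move=> z'; exact: pole_circle_low.
  + by move=> z'; exact: pole_circle_high.
  + by move=> z'; exact: pole_annulus_cont.
by apply: closure_subset => w; rewrite -superlevel_disc// => -[].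
Qed.

Lemma superlevel_boundary_out : boundary superlevel `&` [set z | r1 < normc z] =
  annulus 0 r1 r2 `&` [set z | - V z = - a].
Proof.
apply/seteqP; split=> z.
  move=> [/superlevel_boundary_sub[zS Vz] /= zr]; split; last by rewrite /= Vz.
  rewrite /annulus /= subr0 ltW//= leNgt; apply/negP => /ltW/out_low.
  by rewrite Vz ltxx.
move=> [za /= /oppr_inj Vz].
have /andP[] := za; rewrite subr0 => zl zh.
have zr : r1 < normc z.
  rewrite lt_neqAle zl andbT; apply/eqP => /esym zr.
  by have := out_circle_low (z := z); rewrite subr0 => /(_ zr); rewrite Vz ltxx.
split=> //; split; last first.
  by rewrite interior_superlevel => -[_]; rewrite /= Vz ltxx.
move=> P /nbhsCP[e e0 eP]; have [t zt] := polarP 0 z; rewrite subr0 in zt.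
(* The domain lies on the inner side of this curve, so it is approached inwards along the ray;
   cutting off at [r1] stays where V is monotone. *)
pose x := Num.max r1 (normc z - e / 2).
have xz : x < normc z by rewrite gt_max zr/=; lra.
have x1 : r1 <= x by rewrite le_max lexx.
have x2 : normc z - e / 2 <= x by rewrite le_max lexx orbT.
have nx : normc (polar 0 x t) = x.
  by have := @normc_polar R 0 x t; rewrite subr0; apply; have := r10; lra.
exists (polar 0 x t); split.
  split; first by apply: outside_off_poles; rewrite nx.
  by rewrite -Vz [in ltLHS]zt; exact: out_mono.
by apply: eP; rewrite [in X in _ - X]zt polar_dist ltr_norml; apply/andP; split; lra.
Qed.

Lemma superlevel_has_connectivity : has_connectivity superlevel (size S).+1.
Proof.
(* One disc for each mass and, at the last index, the exterior of the circle of radius [r1]. Points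
   outside all of these have V > a, so the boundary is covered. *)
pose U (j : 'I_(size S).+1) : set R[i] :=
  if (j < size S)%N then disc (nth 0 S j) else [set z | r1 < normc z].
have last_ord (j : 'I_(size S).+1) : (j < size S)%N = false -> j = size S :> nat.
  by move=> jS; apply/eqP; rewrite eqn_leq -ltnS ltn_ord/= leqNgt jS.
apply: (@card_components _ _ _ U).
- move=> j; rewrite /U; case: ifP => _; first exact: open_disc.
  apply: (@open_comp _ _ (@normc R) [set x | r1 < x]); last exact: open_gt.
  by move=> z _; exact: normc_continuous.
- move=> z bz; have [zS Vz] := superlevel_boundary_sub bz.
  have [zr|zr] := leP (normc z) r1; last by exists ord_max => //; rewrite /U /= ltnn.
  have [[s sS sz]|h] := pselect (exists2 s, s \in S & disc s z).
    have sI : (index s S < (size S).+1)%N by rewrite ltnS index_size.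
    by exists (Ordinal sI) => //; rewrite /U /= index_mem sS nth_index.
  suff [_] : superlevel z by rewrite /= Vz ltxx.
  by apply: superlevel_mem => // s sS sz; apply: h; exists s.
- move=> j k z; rewrite /U; case: ifP => jS; case: ifP => kS.
  + move=> jz kz; apply: val_inj => /=; apply/eqP; rewrite -(nth_uniq 0 jS kS uS).
    by apply/eqP/(disc_disjoint _ _ jz kz); exact: mem_nth.
  + move=> jz /= kz; exfalso; have := disc_inside (mem_nth 0 jS) (ltW jz); lra.
  + move=> /= jz kz; exfalso; have := disc_inside (mem_nth 0 kS) (ltW kz); lra.
  + by move=> _ _; apply: val_inj; exact: etrans (last_ord j jS) (esym (last_ord k kS)).
- move=> j; rewrite /U; case: ifP => jS.
    rewrite superlevel_boundary_disc ?mem_nth//; apply: annulus_level_connected => //.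
    + by move=> t; apply: pole_annulus_mono; exact: mem_nth.
    + by move=> z; apply: pole_circle_low; exact: mem_nth.
    + by move=> z; apply: pole_circle_high; exact: mem_nth.
    + by move=> z; apply: pole_annulus_cont; exact: mem_nth.
  rewrite superlevel_boundary_out; apply: (@annulus_level_connected _ (fun z => - V z)) => //.
  + exact: out_annulus_mono.
  + exact: out_circle_low.
  + exact: out_circle_high.
  + exact: out_annulus_cont.
- move=> j; rewrite /U; case: ifP => jS.
    rewrite superlevel_boundary_disc ?mem_nth//; apply: annulus_level_nonempty => //.
    + by move=> t; apply: pole_annulus_mono; exact: mem_nth.
    + by move=> z; apply: pole_circle_low; exact: mem_nth.
    + by move=> z; apply: pole_circle_high; exact: mem_nth.
    + by move=> z; apply: pole_annulus_cont; exact: mem_nth.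
  rewrite superlevel_boundary_out; apply: (@annulus_level_nonempty _ (fun z => - V z)) => //.
  + exact: out_annulus_mono.
  + exact: out_circle_low.
  + exact: out_circle_high.
  + exact: out_annulus_cont.
Qed.

Lemma superlevel_bounded_domain : bounded_domain superlevel.
Proof.
split.
- exists r1%:C; split; first by apply: outside_off_poles; rewrite normcR ger0_norm// ltW.
  have := out_circle_low (z := r1%:C); rewrite subr0 normcR ger0_norm ?ltW// => /(_ erefl).
  by rewrite ltrN2.
- exact: open_superlevel.
- exact: superlevel_connected.
- exact: superlevel_bounded.
- by exists (size S).+1; exact: superlevel_has_connectivity.
Qed.

End SuperlevelDomain.

(** * Choice of the radii for a lens potential *)

Section LensDomain.
Variable R : realType.
Context (S : seq R[i]) (c : R[i] -> R) (uS : uniq S) (c0 : forall s, s \in S -> 0 < c s).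

(** The radii d and [r1] depend on the lens alone, whereas [lo] and the outer radius depend on C. In
    this order every large C is admissible, which leaves room to capture the critical points
    later. *)
Lemma lens_superlevel_domain : exists C0, forall C, C0 <= C ->
  let Omega := superlevel S (lens_potential S c) (- C) in
  [/\ bounded_domain Omega, has_connectivity Omega (size S).+1,
      boundary Omega `<=` [set z | z \notin S /\ lens_potential S c z = - C] &
      closure Omega `<=` [set z | z \notin S]].
Proof.
have [d1 d10 d1P] := seq_common_radius (s := S) (P := fun s d => forall x y t,
  0 < x -> x < y -> y <= d ->
  lens_potential S c (polar s x t) < lens_potential S c (polar s y t))
  (fun s d d' H dd x y t x0 xy yd => H x y t x0 xy (le_trans yd (andP dd).2))
  (fun s sS => lens_potential_increasing_near_pole c0 uS sS).
have [d2 d20 d2P] : exists2 d, 0 < d &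
    forall s, s \in S -> {in S, forall t, s != t -> 2 * d <= normc (s - t)}.
  apply: seq_common_radius => [s d d' H /andP[_ d'd] t tS st|s sS].
    by apply: le_trans (H t tS st); rewrite ler_pM2l.
  apply: seq_common_radius => [t d d' H /andP[_ d'd] st|t tS].
    by apply: le_trans (H st); rewrite ler_pM2l.
  have [->|st] := eqVneq s t; first by exists 1.
  exists (normc (s - t) / 2); first by rewrite divr_gt0// normc_gt0 subr_eq0.
  by move=> _; rewrite mulrC divfK.
pose d := Num.min d1 d2.
have d0 : 0 < d by rewrite lt_min d10.
have [dd1 dd2] : d <= d1 /\ d <= d2 by rewrite /d !ge_min !lexx orbT.
have [M M0 SM] := poles_bounded S.
have [r r0 rP] := lens_potential_decreasing_near_infinity c0.
pose r1 := r + (M + d + 1).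
have r10 : 0 < r1 by rewrite /r1; lra.
pose K := \sum_(s <- S) c s.
(* In the disc of radius [r1] and at distance at least d from the masses, V is at least K ln d -
   r1^2 / 2. *)
exists (r1 ^+ 2 / 2 - K * ln d + 1) => C C0C Omega.
have [lo1 lo10 lo1P] := seq_common_radius (s := S) (P := fun s d => forall z,
  0 < normc (z - s) <= d -> lens_potential S c z < - C)
  (fun s d d' H dd z zd => H z (introT andP (conj (andP zd).1 (le_trans (andP zd).2 (andP dd).2))))
  (fun s sS => lens_potential_low_near_pole c0 (- C) sS).
have [r2' r2'0 r2P] := lens_potential_low_near_infinity c0 (- C).
pose lo := Num.min lo1 (d / 2).
have lo0 : 0 < lo by rewrite lt_min lo10 divr_gt0.
have lod : lo < d by rewrite gt_min; apply/orP; right; lra.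
have lolo1 : lo <= lo1 by rewrite ge_min lexx.
have r12 : r1 < r1 + r2' by lra.
have cV := lens_potential_continuous c0.
have sep : {in S &, forall s t, s != t -> 2 * d <= normc (s - t)}.
  move=> s t sS tS st; apply: le_trans (d2P s sS t tS st); lra.
have inside : {in S, forall s, normc s + d < r1}.
  by move=> s sS; rewrite /r1; have := SM s sS; lra.
have pole_mono : {in S, forall s x y t, 0 < x -> x < y -> y <= d ->
    lens_potential S c (polar s x t) < lens_potential S c (polar s y t)}.
  by move=> s sS x y t x0 xy yd; apply: d1P => //; lra.
have pole_low : {in S, forall s z, 0 < normc (z - s) <= lo -> lens_potential S c z < - C}.
  by move=> s sS z /andP[z0 zl]; apply: (lo1P s sS); rewrite z0/=; lra.
have mid_high z : normc z <= r1 -> {in S, forall s, d <= normc (z - s)} ->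
    - C < lens_potential S c z.
  move=> z1 zd; have := log_potential_lb c0 d0 zd; rewrite -/K /lens_potential.
  have : normc z ^+ 2 <= r1 ^+ 2 by rewrite ler_sqr ?nnegrE ?normc_ge0 ?(ltW r10).
  lra.
have out_mono x y t : r1 <= x -> x < y ->
    lens_potential S c (polar 0 y t) < lens_potential S c (polar 0 x t).
  by move=> x1 xy; apply: rP => //; move: x1; rewrite /r1; lra.
have out_low z : r1 + r2' <= normc z -> lens_potential S c z < - C.
  by move=> zr; apply: r2P; lra.
split.
- exact: (superlevel_bounded_domain uS lo0 lod r12 cV sep inside pole_mono pole_low
    mid_high out_mono out_low r10).
- exact: (superlevel_has_connectivity uS lo0 lod r12 cV sep inside pole_mono pole_low
    mid_high out_mono out_low r10).
- by move=> z bz; have := superlevel_boundary_sub lo0 cV pole_low bz.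
- by move=> z /(superlevel_closure lo0 cV pole_low)[].
Qed.
End LensDomain.

(** * Partial derivatives *)

Section Partials.
Variable R : realType.
Implicit Types (O : set R[i]) (g gx gy : R[i] -> R) (z s : R[i]).

Lemma is_derive_shift_sqr (a b t : R) :
  is_derive t 1 (fun t : R => (t - a) ^+ 2 + b) (2 * (t - a)).
Proof.
have -> : (fun t : R => (t - a) ^+ 2 + b) = (@idfun R - cst a) ^+ 2 + cst b by [].
apply: is_derive_eq; rewrite /= /GRing.scale/= subr0 addr0 expr1 mulr1 mulr_natl.
by [].
Qed.

Lemma is_derive_quot (f g : R -> R) (t f' g' : R) : g t != 0 ->
  is_derive t 1 f f' -> is_derive t 1 g g' ->
  is_derive t 1 (fun t => f t / g t) ((f' * g t - f t * g') / g t ^+ 2).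
Proof.
move=> g0 df dg; have dV := is_deriveV g0 dg.
apply: is_derive_eq; rewrite /GRing.scale/=.
by field.
Qed.

Lemma is_derive_half_ln (g : R -> R) (t g' : R) : 0 < g t -> is_derive t 1 g g' ->
  is_derive t 1 (fun t => ln (g t) / 2) (g' / 2 / g t).
Proof.
move=> g0 dg; have dl := is_derive1_ln g0.
have -> : (fun t => ln (g t) / 2) = 2^-1 \*: (@ln R \o g).
  by apply/funext => x /=; rewrite mulrC.
have dc := is_derive1_comp dl dg.
by apply: is_derive_eq; rewrite /GRing.scale/=; field; rewrite gt_eqF.
Qed.

(** Naming the candidate partials lets them be computed term by term; on an open set they yield
    [C1_on] and the values of [dx] and [dy]. *)
Definition has_partials O g gx gy := forall z, O z ->
  [/\ is_derive (complex.Re z) 1 (hline g z) (gx z),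
      is_derive (complex.Im z) 1 (Defs.vline g z) (gy z),
      {for z, continuous gx} & {for z, continuous gy}].

Lemma near_hline O z : open O -> O z -> \forall t \near complex.Re z, O (t +i* complex.Im z).
Proof.
move=> oO Oz; have : {for complex.Re z, continuous (fun t => t +i* complex.Im z)}.
  by apply: (@Complex_continuous R R id (cst (complex.Im z))); [by []|exact: cst_continuous].
by apply; case: z Oz => x y Oz; exact: open_nbhs_nbhs.
Qed.

Lemma near_vline O z : open O -> O z -> \forall t \near complex.Im z, O (complex.Re z +i* t).
Proof.
move=> oO Oz; have : {for complex.Im z, continuous (fun t => complex.Re z +i* t)}.
  by apply: (@Complex_continuous R R (cst (complex.Re z)) id); [exact: cst_continuous|by []].
by apply; case: z Oz => x y Oz; exact: open_nbhs_nbhs.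
Qed.

Lemma has_partials_eq O g h gx gy : open O -> (forall z, O z -> g z = h z) ->
  has_partials O g gx gy -> has_partials O h gx gy.
Proof.
move=> oO gh gP z Oz; have [dgx dgy cx cy] := gP z Oz; split=> //.
  apply: near_eq_is_derive dgx; have := near_hline oO Oz.
  by apply: filterS => t; exact: gh.
apply: near_eq_is_derive dgy; have := near_vline oO Oz.
by apply: filterS => t; exact: gh.
Qed.

Lemma has_partials_dxE O g gx gy z : has_partials O g gx gy -> O z -> dx g z = gx z.
Proof.
by move=> gP Oz; have [[_ <-] _ _ _] := gP z Oz; rewrite /dx derive1E.
Qed.

Lemma has_partials_dyE O g gx gy z : has_partials O g gx gy -> O z -> dy g z = gy z.
Proof.
by move=> gP Oz; have [_ [_ <-] _ _] := gP z Oz; rewrite /dy derive1E.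
Qed.

Lemma continuous_at_eq O (g h : R[i] -> R) z : open O -> O z -> (forall z, O z -> g z = h z) ->
  {for z, continuous g} -> {for z, continuous h}.
Proof.
move=> oO Oz gh cg P; rewrite -(gh z Oz) => /cg gP.
have nO := open_nbhs_nbhs (conj oO Oz); have nP : nbhs z (g @^-1` P) := gP.
change (nbhs z (h @^-1` P)); apply: filterS2 nO nP => w Ow.
by rewrite /= gh.
Qed.

Lemma has_partials_C1 O g gx gy : open O -> has_partials O g gx gy -> C1_on O g.
Proof.
move=> oO gP z Oz; have [[dgx _] [dgy _] cx cy] := gP z Oz.
split; [exact: dgx|exact: dgy| |].
  by apply: (continuous_at_eq oO Oz _ cx) => w Ow; rewrite (has_partials_dxE gP).
by apply: (continuous_at_eq oO Oz _ cy) => w Ow; rewrite (has_partials_dyE gP).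
Qed.

Lemma has_partialsD O g h gx gy hx hy : has_partials O g gx gy -> has_partials O h hx hy ->
  has_partials O (g \+ h) (gx \+ hx) (gy \+ hy).
Proof.
move=> gP hP z Oz; have [? ? ? ?] := gP z Oz; have [? ? ? ?] := hP z Oz; split.
- have -> : hline (g \+ h) z = hline g z + hline h z by [].
  exact: is_deriveD.
- have -> : Defs.vline (g \+ h) z = Defs.vline g z + Defs.vline h z by [].
  exact: is_deriveD.
- exact: continuousD.
- exact: continuousD.
Qed.

Lemma has_partialsZ O g gx gy (k : R) : has_partials O g gx gy ->
  has_partials O (fun z => k * g z) (fun z => k * gx z) (fun z => k * gy z).
Proof.
move=> gP z Oz; have [? ? ? ?] := gP z Oz; split.
- have -> : hline (fun z => k * g z) z = k \*: hline g z by [].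
  exact: is_deriveZ.
- have -> : Defs.vline (fun z => k * g z) z = k \*: Defs.vline g z by [].
  exact: is_deriveZ.
- by apply: continuousM => //; exact: cst_continuous.
- by apply: continuousM => //; exact: cst_continuous.
Qed.

Lemma has_partials_cst O (k : R) : has_partials O (cst k) (cst 0) (cst 0).
Proof.
by move=> z Oz; split; try exact: cst_continuous; exact: is_derive_cst.
Qed.

Lemma has_partials_sum O (S : seq R[i]) (c : R[i] -> R) (g gx gy : R[i] -> R[i] -> R) :
  {in S, forall s, has_partials O (g s) (gx s) (gy s)} ->
  has_partials O (fun z => \sum_(s <- S) c s * g s z) (fun z => \sum_(s <- S) c s * gx s z)
    (fun z => \sum_(s <- S) c s * gy s z).
Proof.
have E h s (T : seq R[i]) : (fun z => \sum_(t <- s :: T) c t * h t z) =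
    (fun z : R[i] => c s * h s z) \+ (fun z => \sum_(t <- T) c t * h t z).
  by apply/funext => z; rewrite big_cons.
elim: S => [|s S IH] H.
  have E0 (h : R[i] -> R[i] -> R) : (fun z : R[i] => \sum_(t <- [::]) c t * h t z) = cst 0.
    by apply/funext => z; rewrite big_nil.
  rewrite !E0; exact: has_partials_cst.
rewrite !E; apply: has_partialsD; first by apply/has_partialsZ/H/mem_head.
by apply: IH => t tS; apply: H; rewrite inE tS orbT.
Qed.

Lemma has_partials_subset (O O' : set R[i]) g hx hy : O `<=` O' ->
  has_partials O' g hx hy -> has_partials O g hx hy.
Proof. by move=> OO H z /OO/H. Qed.

Lemma has_partialsB (O : set R[i]) g h g1 g2 h1 h2 :
  has_partials O g g1 g2 -> has_partials O h h1 h2 ->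
  has_partials O (fun z => g z - h z) (fun z => g1 z - h1 z) (fun z => g2 z - h2 z).
Proof.
move=> gP hP; have := has_partialsD gP (has_partialsZ (-1) hP).
have E (p q : R[i] -> R) : p \+ (fun z => -1 * q z) = (fun z => p z - q z).
  by apply/funext => z /=; rewrite mulN1r.
by rewrite !E.
Qed.

Lemma has_partials_Re O : has_partials O (@complex.Re R) (cst 1) (cst 0).
Proof.
move=> z Oz; split; try exact: cst_continuous; first exact: is_derive_id.
exact: is_derive_cst.
Qed.

Lemma has_partials_Im O : has_partials O (@complex.Im R) (cst 0) (cst 1).
Proof.
move=> z Oz; split; try exact: cst_continuous; first exact: is_derive_cst.
exact: is_derive_id.
Qed.

Lemma has_partials_half_sqr_normc O :
  has_partials O (fun z => normc z ^+ 2 / 2) (@complex.Re R) (@complex.Im R).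
Proof.
have E (b t : R) : is_derive t 1 (fun x : R => (x ^+ 2 + b) / 2) t.
  have := is_derive_shift_sqr 0 b t; rewrite subr0.
  have -> : (fun x : R => (x - 0) ^+ 2 + b) = (fun x => x ^+ 2 + b).
    by apply/funext => x; rewrite subr0.
  move=> h; have -> : (fun x : R => (x ^+ 2 + b) / 2) = 2^-1 \*: (fun x => x ^+ 2 + b).
    by apply/funext => x /=; rewrite mulrC.
  by apply: is_derive_eq; rewrite /GRing.scale/= mulrA mulVf ?mul1r.
move=> z Oz; split; [| |exact: Re_continuous|exact: Im_continuous].
  have -> : hline (fun z => normc z ^+ 2 / 2) z =
    (fun x => (x ^+ 2 + complex.Im z ^+ 2) / 2) by apply/funext => x; rewrite /hline normc_sqr.
  exact: E.
have -> : Defs.vline (fun z => normc z ^+ 2 / 2) z =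
    (fun x => (x ^+ 2 + complex.Re z ^+ 2) / 2).
  by apply/funext => x; rewrite /Defs.vline normc_sqr addrC.
exact: E.
Qed.

Lemma ReB z w : complex.Re (z - w) = complex.Re z - complex.Re w.
Proof. by case: z w => ? ? []. Qed.

Lemma ImB z w : complex.Im (z - w) = complex.Im z - complex.Im w.
Proof. by case: z w => ? ? []. Qed.

Section LogPole.
Variable s : R[i].
Let X z := complex.Re z - complex.Re s.
Let Y z := complex.Im z - complex.Im s.
Let Q z := X z ^+ 2 + Y z ^+ 2.

Lemma sqr_dist_gt0 z : z != s -> 0 < Q z.
Proof.
move=> zs; have : 0 < normc (z - s) ^+ 2 by rewrite exprn_gt0// normc_gt0 subr_eq0.
by rewrite normc_sqr ReB ImB.
Qed.

Lemma sqr_dist_neq0 z : z != s -> Q z != 0.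
Proof. by move=> zs; rewrite gt_eqF// sqr_dist_gt0. Qed.

(** Removes the square root: along horizontal and vertical lines Q is a quadratic polynomial. *)
Lemma ln_normcE z : z != s -> ln (normc (z - s)) = ln (Q z) / 2.
Proof.
move=> zs; have n0 : 0 < normc (z - s) by rewrite normc_gt0 subr_eq0.
have -> : Q z = normc (z - s) ^+ 2 by rewrite normc_sqr ReB ImB.
by rewrite lnXn// mulr2n; lra.
Qed.

Lemma open_punctured : open [set z | z != s].
Proof.
rewrite openE => z /= zs; apply/nbhsCP; exists (normc (z - s)); first by rewrite normc_gt0 subr_eq0.
by move=> w; apply: contraTN => /eqP ->; rewrite normcB ltxx.
Qed.

Lemma X_continuous : continuous X.
Proof.
by move=> z; apply: continuousB; [exact: Re_continuous|exact: cst_continuous].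
Qed.

Lemma Y_continuous : continuous Y.
Proof.
by move=> z; apply: continuousB; [exact: Im_continuous|exact: cst_continuous].
Qed.

Lemma continuous_sqr (f : R[i] -> R) z : {for z, continuous f} ->
  {for z, continuous (fun z => f z ^+ 2)}.
Proof.
move=> cf; apply: (@continuous_comp _ _ _ f (fun x => x ^+ 2)) => //.
exact: exprn_continuous.
Qed.

Lemma Q_continuous : continuous Q.
Proof.
move=> z; apply: (@continuousD _ _ _ (fun z => X z ^+ 2) (fun z => Y z ^+ 2));
by apply: continuous_sqr; [exact: X_continuous || exact: Y_continuous].
Qed.

Lemma continuous_div (f g : R[i] -> R) z : g z != 0 -> {for z, continuous f} ->
  {for z, continuous g} -> {for z, continuous (fun z => f z / g z)}.
Proof.
move=> g0 cf cg; apply: continuousM => //; apply: continuousV => //.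
Qed.

Lemma is_derive_Q_hline z : is_derive (complex.Re z) 1 (hline Q z) (2 * X z).
Proof.
have -> : hline Q z = (fun t => (t - complex.Re s) ^+ 2 + Y z ^+ 2) by [].
exact: is_derive_shift_sqr.
Qed.

Lemma is_derive_Q_vline z : is_derive (complex.Im z) 1 (Defs.vline Q z) (2 * Y z).
Proof.
have -> : Defs.vline Q z = (fun t => (t - complex.Im s) ^+ 2 + X z ^+ 2).
  by apply/funext => t; rewrite /Defs.vline /Q addrC.
exact: is_derive_shift_sqr.
Qed.

Lemma has_partials_ln : has_partials [set z | z != s] (fun z => ln (normc (z - s)))
  (fun z => X z / Q z) (fun z => Y z / Q z).
Proof.
apply: (@has_partials_eq _ (fun z => ln (Q z) / 2)); first exact: open_punctured.
  by move=> z /= zs; rewrite ln_normcE.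
move=> [x y] /= zs; have q0 := sqr_dist_gt0 zs.
have qn0 := sqr_dist_neq0 zs.
split.
- have := is_derive_half_ln (g := hline Q (x +i* y)) q0 (is_derive_Q_hline (x +i* y)).
  by move=> h; apply: (is_derive_eq h); congr (_ / _); rewrite mulrC mulKf ?pnatr_eq0.
- have := is_derive_half_ln (g := Defs.vline Q (x +i* y)) q0 (is_derive_Q_vline (x +i* y)).
  by move=> h; apply: (is_derive_eq h); congr (_ / _); rewrite mulrC mulKf ?pnatr_eq0.
- by apply: continuous_div => //; [exact: X_continuous|exact: Q_continuous].
- by apply: continuous_div => //; [exact: Y_continuous|exact: Q_continuous].
Qed.

Lemma is_derive_X (t : R) a : is_derive t 1 (fun t : R => t - a) 1.
Proof.
have -> : (fun t : R => t - a) = @idfun R - cst a by [].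
by apply: is_derive_eq; rewrite subr0.
Qed.

Lemma has_partials_lnx : has_partials [set z | z != s] (fun z => X z / Q z)
  (fun z => (Y z ^+ 2 - X z ^+ 2) / Q z ^+ 2) (fun z => - (2 * X z * Y z) / Q z ^+ 2).
Proof.
move=> [x y] /= zs; have qn0 := sqr_dist_neq0 zs.
have q2 : Q (x +i* y) ^+ 2 != 0 by rewrite expf_neq0.
have cQ2 : {for (x +i* y), continuous (fun z => Q z ^+ 2)}.
  exact/continuous_sqr/Q_continuous.
split.
- have := is_derive_quot (f := hline X (x +i* y)) (g := hline Q (x +i* y)) qn0
    (is_derive_X _ _) (is_derive_Q_hline (x +i* y)).
  by move=> h; apply: (is_derive_eq h); congr (_ / _); rewrite /hline /Q /X /Y /=; ring.
- have := is_derive_quot (f := Defs.vline X (x +i* y)) (g := Defs.vline Q (x +i* y)) qn0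
    (is_derive_cst (X (x +i* y)) _ _) (is_derive_Q_vline (x +i* y)).
  by move=> h; apply: (is_derive_eq h); congr (_ / _); rewrite /Defs.vline /Q /X /Y /=; ring.
- apply: continuous_div => //; apply: continuousB; apply: continuous_sqr.
    exact: Y_continuous.
  exact: X_continuous.
- apply: continuous_div => //; apply: continuousN; apply: continuousM; last exact: Y_continuous.
  by apply: continuousM; [exact: cst_continuous|exact: X_continuous].
Qed.

Lemma has_partials_lny : has_partials [set z | z != s] (fun z => Y z / Q z)
  (fun z => - (2 * X z * Y z) / Q z ^+ 2) (fun z => (X z ^+ 2 - Y z ^+ 2) / Q z ^+ 2).
Proof.
move=> [x y] /= zs; have qn0 := sqr_dist_neq0 zs.
have q2 : Q (x +i* y) ^+ 2 != 0 by rewrite expf_neq0.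
have cQ2 : {for (x +i* y), continuous (fun z => Q z ^+ 2)}.
  exact/continuous_sqr/Q_continuous.
split.
- have := is_derive_quot (f := hline Y (x +i* y)) (g := hline Q (x +i* y)) qn0
    (is_derive_cst (Y (x +i* y)) _ _) (is_derive_Q_hline (x +i* y)).
  by move=> h; apply: (is_derive_eq h); congr (_ / _); rewrite /hline /Q /X /Y /=; ring.
- have := is_derive_quot (f := Defs.vline Y (x +i* y)) (g := Defs.vline Q (x +i* y)) qn0
    (is_derive_X _ _) (is_derive_Q_vline (x +i* y)).
  by move=> h; apply: (is_derive_eq h); congr (_ / _); rewrite /Defs.vline /Q /X /Y /=; ring.
- apply: continuous_div => //; apply: continuousN; apply: continuousM; last exact: Y_continuous.
  by apply: continuousM; [exact: cst_continuous|exact: X_continuous].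
- apply: continuous_div => //; apply: continuousB; apply: continuous_sqr.
    exact: X_continuous.
  exact: Y_continuous.
Qed.

End LogPole.
End Partials.

(** * The landscape function and its critical points *)

Section Landscape.
Variable R : realType.
Context (S : seq R[i]) (c : R[i] -> R).

Let X (s z : R[i]) := complex.Re z - complex.Re s.
Let Y (s z : R[i]) := complex.Im z - complex.Im s.
Let Q s z := X s z ^+ 2 + Y s z ^+ 2.
Let offS : set R[i] := [set z | z \notin S].

Definition lens_field (z : R[i]) : R[i] := \sum_(s <- S) (c s)%:C / (z - s).

Let open_offS : open offS := @open_off_poles R S.

Lemma Re_sum (I : Type) (r : seq I) (F : I -> R[i]) :
  complex.Re (\sum_(i <- r) F i) = \sum_(i <- r) complex.Re (F i).
Proof. by elim/big_rec2: _ => // i x y _ <-; case: (F i) y => ? ? []. Qed.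

Lemma Im_sum (I : Type) (r : seq I) (F : I -> R[i]) :
  complex.Im (\sum_(i <- r) F i) = \sum_(i <- r) complex.Im (F i).
Proof. by elim/big_rec2: _ => // i x y _ <-; case: (F i) y => ? ? []. Qed.

Lemma Re_lens_field z : complex.Re (lens_field z) = \sum_(s <- S) c s * (X s z / Q s z).
Proof.
rewrite Re_sum; apply: eq_bigr => s _; rewrite /Q /X /Y; case: z s => x y [a b] /=; ring.
Qed.

Lemma Im_lens_field z : complex.Im (lens_field z) = - \sum_(s <- S) c s * (Y s z / Q s z).
Proof.
rewrite Im_sum -sumrN; apply: eq_bigr => s _; rewrite /Q /X /Y; case: z s => x y [a b] /=; ring.
Qed.

Let sub_off s : s \in S -> offS `<=` [set z | z != s].
Proof. by move=> sS z; apply: contraNneq => ->. Qed.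

Let gx z := \sum_(s <- S) c s * (X s z / Q s z) - complex.Re z.
Let gy z := \sum_(s <- S) c s * (Y s z / Q s z) - complex.Im z.
Let gxx z := \sum_(s <- S) c s * ((Y s z ^+ 2 - X s z ^+ 2) / Q s z ^+ 2) - 1.
(** The final 0 is the mixed partial of |z|^2 / 2, kept so that the expression has the form produced
    by [has_partialsB]. *)
Let gxy z := \sum_(s <- S) c s * (- (2 * X s z * Y s z) / Q s z ^+ 2) - 0.
Let gyy z := \sum_(s <- S) c s * ((X s z ^+ 2 - Y s z ^+ 2) / Q s z ^+ 2) - 1.

Lemma lens_potential_partials C : has_partials offS (fun z => lens_potential S c z + C) gx gy.
Proof.
have H1 : has_partials offS (lens_potential S c) gx gy.
  apply: has_partialsB; last exact: has_partials_half_sqr_normc.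
  apply: has_partials_sum => s sS; apply: has_partials_subset (sub_off sS) _.
  exact: has_partials_ln.
have := has_partialsD H1 (@has_partials_cst _ offS C).
have E (p : R[i] -> R) : p \+ cst 0 = p by apply/funext => z /=; rewrite addr0.
by rewrite !E.
Qed.

Lemma lens_field_x_partials : has_partials offS gx gxx gxy.
Proof.
apply: has_partialsB; last exact: has_partials_Re.
apply: has_partials_sum => s sS; apply: has_partials_subset (sub_off sS) _.
exact: has_partials_lnx.
Qed.

Lemma lens_field_y_partials : has_partials offS gy gxy gyy.
Proof.
apply: has_partialsB; last exact: has_partials_Im.
apply: has_partials_sum => s sS; apply: has_partials_subset (sub_off sS) _.
exact: has_partials_lny.
Qed.

Lemma lens_potential_dx C z : offS z -> dx (fun z => lens_potential S c z + C) z = gx z.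
Proof. exact: (has_partials_dxE (lens_potential_partials C)). Qed.

Lemma lens_potential_dy C z : offS z -> dy (fun z => lens_potential S c z + C) z = gy z.
Proof. exact: (has_partials_dyE (lens_potential_partials C)). Qed.

Lemma dx_partials C : has_partials offS (dx (fun z => lens_potential S c z + C)) gxx gxy.
Proof.
apply: (@has_partials_eq _ _ gx _ _ _ open_offS) lens_field_x_partials => z zS.
by rewrite lens_potential_dx.
Qed.

Lemma dy_partials C : has_partials offS (dy (fun z => lens_potential S c z + C)) gxy gyy.
Proof.
apply: (@has_partials_eq _ _ gy _ _ _ open_offS) lens_field_y_partials => z zS.
by rewrite lens_potential_dy.
Qed.

Lemma lens_potential_C2 C : C2_on offS (fun z => lens_potential S c z + C).
Proof.
split; apply: has_partials_C1 open_offS _.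
- exact: lens_potential_partials.
- exact: dx_partials.
- exact: dy_partials.
Qed.

(** Each logarithm is harmonic, its two pure second partials being opposite; only the -1 - 1 of
    -|z|^2 / 2 survives. *)
Lemma lens_potential_laplacian C z : offS z ->
  laplacian (fun z => lens_potential S c z + C) z = - 2.
Proof.
move=> zS; rewrite /laplacian (has_partials_dxE (dx_partials C) zS).
rewrite (has_partials_dyE (dy_partials C) zS) /gxx /gyy addrACA -big_split /= big1; first by lra.
by move=> s _; rewrite -mulrDr -mulrDl addrA subrK subrr mul0r mulr0.
Qed.

(** Since 1 / (z - s) is the conjugate of (z - s) / |z - s|^2, the field is the conjugate gradient
    of the logarithmic part, and the conjugate of z is that of |z|^2 / 2. *)
Lemma lens_potential_criticalP C z : offS z ->
  (dx (fun z => lens_potential S c z + C) z = 0 /\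
   dy (fun z => lens_potential S c z + C) z = 0) <-> z^*%C = lens_field z.
Proof.
move=> zS; rewrite lens_potential_dx// lens_potential_dy// /gx /gy -Re_lens_field.
have := Im_lens_field z; set u := \sum_(s <- S) _ => Imu.
case: (lens_field z) Imu => p q /= ->; case: z {zS} @u => x y u /=; split.
  by move=> [/subr0_eq -> /subr0_eq ->].
by move=> [-> /oppr_inj ->]; rewrite !subrr.
Qed.

End Landscape.

(** * Complex differentiability and local logarithms *)

Section ComplexDerivative.
Variable R : realType.
Implicit Types (F G : R[i] -> R[i]) (z w l : R[i]).

(** Complex differentiability as linear approximation with a real error bound; difference quotients
    enter only in [first_order_is_derive]. *)
Definition first_order F z l := forall e : R, 0 < e ->
  exists2 d, 0 < d & forall w, normc (w - z) < d ->
    normc (F w - F z - l * (w - z)) <= e * normc (w - z).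

Lemma first_order_is_derive F z l : first_order F z l -> is_derive z (1 : R[i]) F l.
Proof.
move=> Fl.
have cv : h^-1 *: (F (h *: (1 : R[i]) + z) - F z) @[h --> (0 : R[i])^'] --> l.
  apply/cvgrPdist_lt => e; rewrite ltcE /= => /andP[/eqP ie e0].
  have e20 : 0 < complex.Re e / 2 by rewrite divr_gt0.
  have [d d0 dP] := Fl _ e20.
  near=> h.
  have h0 : h != 0 by near: h; exact: nbhs_dnbhs_neq.
  have hd : normc h < d.
    near: h; apply: nbhs_dnbhs; apply/nbhsCP; exists d => // w; by rewrite subr0.
  rewrite /GRing.scale/= mulr1 distrC normCE ltcE /= ie eqxx /=.
  have := dP (h + z); rewrite addrK => /(_ hd) H.
  have nh0 : 0 < normc h by rewrite normc_gt0.
  have -> : h^-1 * (F (h + z) - F z) - l = h^-1 * (F (h + z) - F z - l * h).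
    by field.
  rewrite normcM normcV mulrC ltr_pdivrMr//; apply: le_lt_trans H _.
  by rewrite ltr_pM2r// ltr_pdivrMr// mulr2n mulrDr mulr1; lra.
split; last exact/cvg_lim.
by apply/cvg_ex; exists l.
Unshelve. all: by end_near. Qed.

Lemma first_order_comp_affine F (a b z : R[i]) l : first_order F (a * z + b) l ->
  first_order (fun w => F (a * w + b)) z (a * l).
Proof.
move=> Fl e e0; have a0 := normc_ge0 a.
have e'0 : 0 < e / (normc a + 1) by rewrite divr_gt0// ltr_wpDl.
have [d d0 dP] := Fl _ e'0.
exists (d / (normc a + 1)); first by rewrite divr_gt0// ltr_wpDl.
move=> w wd; have awz : a * w + b - (a * z + b) = a * (w - z) by ring.
have := dP (a * w + b); rewrite awz normcM => H.
have -> : a * l * (w - z) = l * (a * (w - z)) by ring.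
have n0 := normc_ge0 (w - z).
apply: le_trans (H _) _.
  by move: wd; rewrite ltr_pdivlMr ?ltr_wpDl//; nra.
rewrite mulrA ler_wpM2r// -mulrA ler_piMr ?(ltW e0)//.
by rewrite mulrC ler_pdivrMr ?ltr_wpDl//; lra.
Qed.

Lemma first_orderD F G z l m : first_order F z l -> first_order G z m ->
  first_order (fun w => F w + G w) z (l + m).
Proof.
move=> Fl Gm e e0; have e20 : 0 < e / 2 by rewrite divr_gt0.
have [d d0 dP] := Fl _ e20; have [d' d'0 d'P] := Gm _ e20.
exists (Num.min d d'); first by rewrite lt_min d0.
move=> w; rewrite lt_min => /andP[wd wd'].
have -> : F w + G w - (F z + G z) - (l + m) * (w - z) =
  (F w - F z - l * (w - z)) + (G w - G z - m * (w - z)) by ring.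
apply: le_trans (le_normcD _ _) _; have := dP _ wd; have := d'P _ wd'; lra.
Qed.

Lemma first_order_cst (k z : R[i]) : first_order (cst k) z 0.
Proof.
by move=> e e0; exists 1 => // w _; rewrite /= subrr mul0r subrr normc0 mulr_ge0 ?normc_ge0 ?ltW.
Qed.

Lemma first_orderZ F (k z l : R[i]) : first_order F z l ->
  first_order (fun w => k * F w) z (k * l).
Proof.
move=> Fl e e0; have k0 := normc_ge0 k.
have e'0 : 0 < e / (normc k + 1) by rewrite divr_gt0// ltr_wpDl.
have [d d0 dP] := Fl _ e'0; exists d => // w /dP H.
have -> : k * F w - k * F z - k * l * (w - z) = k * (F w - F z - l * (w - z)) by ring.
rewrite normcM; apply: (@le_trans _ _ ((normc k + 1) * (e / (normc k + 1) * normc (w - z)))).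
  by apply: ler_pM; rewrite ?normc_ge0//; lra.
by rewrite mulrA mulrCA divff ?mulr1// gt_eqF// ltr_wpDl.
Qed.

(** Locating t only by its distance to x covers both orders of x and y, and suffices to keep t in a
    disc. *)
Lemma mean_value (f df : R -> R) (x y : R) :
  (forall t, `|t - x| <= `|y - x| -> is_derive t 1 f (df t)) ->
  exists2 t, `|t - x| <= `|y - x| & f y - f x = df t * (y - x).
Proof.
move=> H; have [xy|xy] := leP x y.
  have yx0 : 0 <= y - x by rewrite subr_ge0.
  have dI t : t \in `[x, y] -> is_derive t 1 f (df t).
    rewrite in_itv/= => /andP[t1 t2]; apply: H; rewrite !ger0_norm ?subr_ge0//; lra.
  have [|t] := @MVT_segment _ f df x y xy (fun t tI => dI t (subset_itv_oo_cc tI)).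
    apply: continuous_subspace_itv => t /dI dt.
    by apply: differentiable_continuous; apply/derivable1_diffP.
  rewrite in_itv/= => /andP[t1 t2] E; exists t => //.
  by rewrite !ger0_norm ?subr_ge0//; lra.
have dI t : t \in `[y, x] -> is_derive t 1 f (df t).
  rewrite in_itv/= => /andP[t1 t2]; apply: H; rewrite !ler0_norm ?subr_le0//; lra.
have [|t] := @MVT_segment _ f df y x (ltW xy) (fun t tI => dI t (subset_itv_oo_cc tI)).
  apply: continuous_subspace_itv => t /dI dt.
  by apply: differentiable_continuous; apply/derivable1_diffP.
rewrite in_itv/= => /andP[t1 t2] E; exists t; first by rewrite !ler0_norm ?subr_le0//; lra.
by rewrite -opprB E -mulrN opprB.
Qed.

Lemma normc_Complex_le (x y x' y' : R) : `|x| <= `|x'| -> `|y| <= `|y'| ->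
  normc (x +i* y) <= normc (x' +i* y').
Proof.
move=> xx yy; rewrite /= ler_sqrt ?addr_ge0 ?sqr_ge0//.
by apply: lerD; rewrite -[leLHS]real_normK ?num_real// -[leRHS]real_normK ?num_real//
  ler_sqr ?nnegrE.
Qed.

(** The path from z to w goes through a corner: the mean value theorem handles the vertical and the
    horizontal leg, and continuity of the partials compares their intermediate values with those at
    z. *)
Lemma partials_first_order (O : set R[i]) g gx gy z : open O -> O z -> has_partials O g gx gy ->
  forall e, 0 < e -> exists2 d, 0 < d & forall w, normc (w - z) < d ->
    `|g w - g z - (gx z * complex.Re (w - z) + gy z * complex.Im (w - z))| <= e * normc (w - z).
Proof.
move=> oO Oz gP e e0.
have [_ _ /continuousCP cx /continuousCP cy] := gP z Oz.
have e20 : 0 < e / 2 by rewrite divr_gt0.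
have [d1 d10 d1P] := cx _ e20; have [d2 d20 d2P] := cy _ e20.
have /nbhsCP[d3 d30 d3P] : nbhs z O by exact: open_nbhs_nbhs.
exists (Num.min d1 (Num.min d2 d3)); first by rewrite !lt_min d10 d20.
case: z Oz {cx cy} d1P d2P d3P => x y Oz d1P d2P d3P [x' y'].
rewrite !lt_min => /and3P[w1 w2 w3].
set n := normc _ in w1 w2 w3 *.
have dh t : `|t - x| <= `|x' - x| -> is_derive t 1 (hline g (x +i* y')) (gx (t +i* y')).
  move=> tx; have [] // := gP (t +i* y'); apply: d3P; apply: le_lt_trans w3.
  exact: normc_Complex_le.
have dv u : `|u - y| <= `|y' - y| -> is_derive u 1 (Defs.vline g (x +i* y)) (gy (x +i* u)).
  move=> uy; have [] // := gP (x +i* u); apply: d3P; apply: le_lt_trans w3.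
  by apply: normc_Complex_le => //; rewrite subrr normr0.
have [t tx Et] := mean_value dh; have [u uy Eu] := mean_value dv.
have dt := d1P (t +i* y') (le_lt_trans (normc_Complex_le tx (lexx `|y' - y|)) w1).
have du : `|gy (x +i* u) - gy (x +i* y)| < e / 2.
  apply: d2P; apply: le_lt_trans w2; apply: normc_Complex_le => //.
  by rewrite subrr normr0.
have -> : g (x' +i* y') - g (x +i* y) -
    (gx (x +i* y) * complex.Re (x' +i* y' - x +i* y) + gy (x +i* y) * complex.Im (x' +i* y' - x +i* y)) =
    (gx (t +i* y') - gx (x +i* y)) * (x' - x) + (gy (x +i* u) - gy (x +i* y)) * (y' - y).
  move: Et Eu; rewrite /hline /Defs.vline /=.
  set A := g (x' +i* y'); set B := g (x +i* y'); set D := g (x +i* y) => EA EB.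
  have -> : A - D = gx (t +i* y') * (x' - x) + gy (x +i* u) * (y' - y).
    by rewrite -EA -EB; ring.
  ring.
apply: le_trans (ler_normD _ _) _; rewrite !normrM.
rewrite [leRHS](_ : _ = e / 2 * n + e / 2 * n); last by field.
have nx : `|x' - x| <= n by exact: (Re_le_normc (x' +i* y' - x +i* y)).
have ny : `|y' - y| <= n by exact: (Im_le_normc (x' +i* y' - x +i* y)).
by apply: lerD; apply: ler_pM => //; exact: ltW.
Qed.

Lemma Cauchy_Riemann (O : set R[i]) (a b ax ay : R[i] -> R) z : open O -> O z ->
  has_partials O a ax ay -> has_partials O b (fun w => - ay w) ax ->
  first_order (fun w => a w +i* b w) z (ax z -i* ay z).
Proof.
move=> oO Oz aP bP e e0; have e20 : 0 < e / 2 by rewrite divr_gt0.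
have [d d0 dP] := partials_first_order oO Oz aP e20.
have [d' d'0 d'P] := partials_first_order oO Oz bP e20.
exists (Num.min d d'); first by rewrite lt_min d0.
move=> w; rewrite lt_min => /andP[/dP wd /d'P wd'].
apply: le_trans (normc_le_ReIm _) _.
have {wd wd'} := lerD wd wd'; rewrite -mulrDl -splitr; apply: le_trans.
case: (w - z) => h k /=; apply: lerD; rewrite le_eqVlt; apply/orP; left; apply/eqP;
  congr (Num.norm _); ring.
Qed.
End ComplexDerivative.

Section LocalLogarithm.
Variable R : realType.
Implicit Types (S : seq R[i]) (c : R[i] -> R) (z w s : R[i]).

Let right_half : set R[i] := [set w | 0 < complex.Re w].

Lemma open_right_half : open right_half.
Proof.
apply: (@open_comp _ _ (@complex.Re R) [set x | 0 < x]); last exact: open_gt.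
by move=> z _; exact: Re_continuous.
Qed.

(** The subtracted zeros keep the form of [has_partials_ln] with its pole at 0. *)
Let ax (w : R[i]) := (complex.Re w - complex.Re (0 : R[i])) /
  ((complex.Re w - complex.Re (0 : R[i])) ^+ 2 + (complex.Im w - complex.Im (0 : R[i])) ^+ 2).
Let ay (w : R[i]) := (complex.Im w - complex.Im (0 : R[i])) /
  ((complex.Re w - complex.Re (0 : R[i])) ^+ 2 + (complex.Im w - complex.Im (0 : R[i])) ^+ 2).

Lemma right_half_neq0 w : right_half w -> w != 0.
Proof. by rewrite /right_half /=; apply: contraTneq => ->; rewrite /= ltxx. Qed.

Lemma half_ln_partials : has_partials right_half (fun w => ln (normc w)) ax ay.
Proof.
have := @has_partials_ln R 0.
have -> : (fun z : R[i] => ln (normc (z - 0))) = (fun z => ln (normc z)).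
  by apply/funext => z; rewrite subr0.
apply: has_partials_subset => w; exact: right_half_neq0.
Qed.

Lemma is_derive_atan_comp (f : R -> R) (t f' : R) : is_derive t 1 f f' ->
  is_derive t 1 (fun t => atan (f t)) ((1 + f t ^+ 2)^-1 * f').
Proof. by move=> df; exact: (is_derive1_comp (is_derive1_atan (f t)) df). Qed.

Lemma arg_partials : has_partials right_half (fun w => atan (complex.Im w / complex.Re w))
  (fun w => - ay w) ax.
Proof.
move=> [x y] wr; have [_ _ cx cy] := half_ln_partials wr.
have x0 : x != 0 by rewrite gt_eqF.
have d0 : x ^+ 2 + y ^+ 2 != 0.
  by rewrite gt_eqF// ltr_pwDl ?sqr_ge0// exprn_gt0.
split=> //; last exact: continuousN.
- have h := is_derive_atan_comp (is_derive_quot (g := id) (t := x) x0 (is_derive_cst y _ _) (is_derive_id _ _)).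
  apply: (is_derive_eq h); rewrite /ay /= !subr0; field.
  by rewrite x0 d0.
- have h := is_derive_atan_comp (is_derive_quot (g := cst x) (t := y) x0 (is_derive_id _ _) (is_derive_cst x _ _)).
  apply: (is_derive_eq h); rewrite /ax /= !subr0; field.
  by rewrite x0 d0.
Qed.

(** The principal logarithm on the right half plane, where [atan] of the slope is the argument. *)
Definition Log w : R[i] := ln (normc w) +i* atan (complex.Im w / complex.Re w).

Lemma Log_first_order w : 0 < complex.Re w -> first_order Log w w^-1.
Proof.
move=> w0; have := Cauchy_Riemann open_right_half w0 half_ln_partials arg_partials.
suff -> : ax w -i* ay w = w^-1 by [].
by rewrite /ax /ay; case: w w0 => x y _ /=; rewrite !subr0.
Qed.

(** Near [z0] the quotient (z - s) / (z0 - s) is within distance 1 of 1, hence in the right half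
    plane. Adding the real constant ln |z0 - s| to its [Log] restores the real part. *)
Lemma local_logarithm z0 s : z0 != s -> exists L : R[i] -> R[i],
  \forall z \near z0, first_order L z (z - s)^-1 /\ complex.Re (L z) = ln (normc (z - s)).
Proof.
move=> zs; have zs0 : z0 - s != 0 by rewrite subr_eq0.
have n0 : 0 < normc (z0 - s) by rewrite normc_gt0.
pose a := (z0 - s)^-1; pose b := - (a * s).
have abE z : a * z + b = (z - s) / (z0 - s) by rewrite /b /a; field.
exists (fun z => Log (a * z + b) + (ln (normc (z0 - s)))%:C).
have near1 : \forall z \near z0, normc (z - z0) < normc (z0 - s).
  by apply/nbhsCP; exists (normc (z0 - s)).
apply: filterS near1 => z zz0.
have zs' : z - s != 0.
  rewrite subr_eq0; apply: contraTneq zz0 => ->.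
  by rewrite normcB ltxx.
have re0 : 0 < complex.Re (a * z + b).
  have -> : a * z + b = 1 + (z - z0) / (z0 - s) by rewrite abE; field.
  have : normc ((z - z0) / (z0 - s)) < 1 by rewrite normcM normcV ltr_pdivrMr// mul1r.
  have := Re_le_normc ((z - z0) / (z0 - s)).
  case: (_ / _) => p q /= h1 h2.
  by have := le_lt_trans h1 h2; rewrite ltr_norml; lra.
split.
  have := first_orderD (first_order_comp_affine (Log_first_order re0))
    (first_order_cst (ln (normc (z0 - s)))%:C z).
  rewrite addr0; suff -> : a * (a * z + b)^-1 = (z - s)^-1 by [].
  by rewrite abE /a; field; rewrite zs0 zs'.
rewrite abE /Log /= normcM normcV ln_div ?posrE ?normc_gt0// subrK.
by [].
Qed.

Lemma local_lens_primitive S c (C : R) z0 : z0 \notin S -> exists F : R[i] -> R[i],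
  \forall z \near z0, first_order F z (lens_field S c z) /\
    complex.Re (F z) = log_potential S c z + C.
Proof.
elim: S => [|s S IH] /=.
  move=> _; exists (cst C%:C); apply: filterE => z; rewrite /lens_field /log_potential !big_nil add0r.
  by split=> //; exact: first_order_cst.
rewrite inE negb_or => /andP[zs /IH[F nF]]; have [L nL] := local_logarithm zs.
exists (fun z => (c s)%:C * L z + F z).
apply: filterS2 nL nF => z [dL ReL] [dF ReF]; split.
  rewrite /lens_field big_cons; apply: first_orderD dF; exact: first_orderZ.
rewrite /log_potential big_cons -addrA -/(log_potential S c z) -ReF -ReL.
by case: (L z) (F z) => p q [p' q'] /=; ring.
Qed.
End LocalLogarithm.

(** * From lenses to RL-domains *)

Section LensFraction.
Variable R : realType.
Context (S : seq R[i]) (c : R[i] -> R) (uS : uniq S) (c0 : forall s, s \in S -> 0 < c s).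

Definition lens_den : {poly R[i]} := \prod_(s <- S) ('X - s%:P).
Definition lens_num : {poly R[i]} :=
  \sum_(s <- S) (c s)%:C *: \prod_(t <- rem s S) ('X - t%:P).

Lemma root_lens_den z : (lens_den.[z] != 0) = (z \notin S).
Proof. by rewrite -[_ == 0]/(root _ _) root_prod_XsubC. Qed.

Lemma lens_fractionE z : z \notin S -> lens_num.[z] / lens_den.[z] = lens_field S c z.
Proof.
move=> zS; rewrite /lens_num horner_sum mulr_suml /lens_field big_seq [RHS]big_seq.
apply: eq_bigr => s sS; rewrite hornerZ /lens_den (big_rem s sS)/= hornerM hornerXsubC.
set Q := _.[z].
have Q0 : Q != 0.
  by rewrite -[_ == 0]/(root _ _) root_prod_XsubC; apply: contra zS; exact: mem_rem.
have zs : z - s != 0 by rewrite subr_eq0; apply: contraNneq zS => ->.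
by field; rewrite Q0 zs.
Qed.

Lemma size_lens_den : size lens_den = (size S).+1.
Proof. exact: size_prod_XsubC. Qed.

Lemma size_lens_num : (size lens_num <= size S)%N.
Proof.
rewrite /lens_num big_seq; apply: leq_trans (size_sum _ _ _) _; apply/bigmax_leqP_seq => s sS _.
apply: leq_trans (size_scale_leq _ _) _; rewrite size_prod_XsubC size_rem//.
by case: (S) sS.
Qed.

(** At s every term of the numerator but the one indexed by s has a vanishing factor. As the
    denominator is a product of linear factors, this gives lowest terms. *)
Lemma lens_num_pole s : s \in S -> lens_num.[s] != 0.
Proof.
move=> sS; rewrite /lens_num horner_sum (big_rem s sS)/=.
set rest := (X in _ + X); have -> : rest = 0.
  rewrite /rest big_seq big1// => t; rewrite mem_rem_uniq// !inE => /andP[ts tS].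
  rewrite hornerZ; apply/eqP; rewrite mulf_eq0; apply/orP; right.
  by rewrite -[_ == 0]/(root _ _) root_prod_XsubC mem_rem_uniq// !inE sS eq_sym ts.
rewrite addr0 hornerZ; apply: mulf_neq0.
  by rewrite eq_complex /= eqxx andbT gt_eqF ?c0.
by rewrite -[_ == 0]/(root _ _) root_prod_XsubC mem_rem_uniq// !inE eqxx.
Qed.

Lemma coprime_lens : coprimep lens_num lens_den.
Proof.
have H T : {subset T <= S} -> coprimep lens_num (\prod_(s <- T) ('X - s%:P)).
  elim: T => [|s T IH] TS; first by rewrite big_nil coprimep1.
  rewrite big_cons coprimepMr IH ?andbT; last by move=> t tT; apply: TS; rewrite inE tT orbT.
  rewrite coprimep_XsubC; apply: lens_num_pole; exact/TS/mem_head.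
exact: H.
Qed.

Lemma lens_Re_primitive (C : R) :
  is_Re_primitive lens_num lens_den (fun z => log_potential S c z + C).
Proof.
move=> z0; rewrite root_lens_den => zS.
have [F nF] := local_lens_primitive c C zS; exists F.
have nS : \forall z \near z0, z \notin S.
  by apply: open_nbhs_nbhs; split=> //; exact: open_off_poles.
apply: filterS2 nS nF => z zS' [dF ReF]; split=> //.
rewrite lens_fractionE//; exact: first_order_is_derive.
Qed.

Theorem lens_landscape (N : nat) :
  [set z | z \notin S /\ z^*%C = lens_field S c z] #= `I_N ->
  exists Omega : set R[i],
    [/\ RL_domain_of_order (size S) Omega, has_connectivity Omega (size S).+1 &
      exists v : R[i] -> R,
        landscape_function Omega v /\ critical_points Omega v #= `I_N].
Proof.
set Z := [set z | _] => cardZ.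
have finZ : finite_set Z by exists N.
have [C0 C0P] := lens_superlevel_domain uS c0.
(* Finitely many solutions allow a single level below all critical values; the sum of absolute
   values is a crude bound. *)
have [C1 C1P] : exists C1 : R, forall z, Z z -> - C1 < lens_potential S c z.
  have /finite_seqP[T ZT] := finZ.
  exists (\sum_(z <- T) `|lens_potential S c z| + 1) => z; rewrite ZT /= => zT.
  rewrite (big_rem z zT)/=.
  have : 0 <= \sum_(y <- rem z T) `|lens_potential S c y| by apply: sumr_ge0.
  have := ler_norm (- lens_potential S c z); rewrite normrN; lra.
pose C := Num.max C0 C1.
have C0C : C0 <= C by rewrite le_max lexx.
have C1C : C1 <= C by rewrite le_max lexx orbT.
have [dom conn bdry clos] := C0P C C0C.
set Omega := superlevel _ _ _ in dom conn bdry clos.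
have OS : Omega `<=` [set z | z \notin S] by move=> z [].
exists Omega; split=> //.
(* On the boundary V = -C, which says exactly that twice this u equals |z|^2. *)
- split=> //; exists lens_num, lens_den, (fun z => log_potential S c z + C); split.
  + split; first exact: coprime_lens.
    by rewrite size_lens_den (maxn_idPr _)//; apply: leq_trans size_lens_num _.
  + exact: lens_Re_primitive.
  + by move=> z /OS; rewrite /= root_lens_den.
  + move=> z /bdry[zS Vz]; split; first by rewrite /= root_lens_den.
    have -> : 2 * (log_potential S c z + C) = normc z ^+ 2.
      by move: Vz; rewrite /lens_potential; lra.
    by rewrite normCE -rmorphXn.
- exists (fun z => lens_potential S c z + C); split; first split.
  + have [h1 h2 h3] := lens_potential_C2 S c C.
    by split=> z /OS zS; [exact: h1|exact: h2|exact: h3].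
  + by move=> z; rewrite inE => /OS; exact: lens_potential_laplacian.
  + apply: continuous_in_subspaceT => z; rewrite inE => /clos zS.
    by apply: continuousD; [exact: lens_potential_continuous|exact: cst_continuous].
  + by move=> z; rewrite inE => /bdry[_ ->]; rewrite addNr.
- suff -> : critical_points Omega (fun z => lens_potential S c z + C) = Z by [].
  apply/seteqP; split=> z.
    move=> [/OS zS d1 d2]; split=> //; apply/lens_potential_criticalP; first exact: zS.
    by split; [exact: d1|exact: d2].
  move=> Zz; have [zS zE] := Zz.
  have [d1 d2] := (lens_potential_criticalP c C zS).2 zE.
  by split=> //; split=> //=; have := C1P z Zz; lra.
Qed.
End LensFraction.

(** * Counting the solutions of the lens equation *)

Section Counting.
Variable R : realType.

Lemma card_seq_set (T : choiceType) (x0 : T) (s : seq T) : uniq s -> [set` s] #= `I_(size s).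
Proof.
move=> us; have -> : [set` s] = nth x0 s @` `I_(size s).
  apply/seteqP; split=> [x /= xs|_ [i /= isz <-]]; last exact: mem_nth.
  by exists (index x s); [rewrite /= index_mem|exact: nth_index].
rewrite (card_eql (inj_card_eq _))// => i j; rewrite !inE /= => isz jsz /eqP.
by rewrite nth_uniq// => /eqP.
Qed.

(** The roots are distinct because the derivative m X^(m-1) vanishes only at 0, where X^m - a does
    not. *)
Lemma nth_roots (m : nat) (a : R[i]) : (0 < m)%N -> a != 0 -> exists rs : seq R[i],
  [/\ uniq rs, size rs = m, forall z, (z \in rs) = (z ^+ m == a) &
      'X^m - a%:P = \prod_(r <- rs) ('X - r%:P)].
Proof.
move=> m0 a0; set p := 'X^m - a%:P.
have p_monic : p \is monic by exact: monicXnsubC.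
have [rs] := closed_field_poly_normal p; rewrite (monicP p_monic) scale1r => pE.
exists rs; split=> //.
- rewrite -separable.separable_prod_XsubC -pE separable.separable_poly.unlock.
  rewrite /p derivB derivXn derivC subr0.
  rewrite -scaler_nat coprimepZr ?pnatr_eq0 -?lt0n//; apply: coprimep_expr.
  by rewrite coprimepX /root !hornerE expr0n gtn_eqF// sub0r oppr_eq0.
- by apply/succn_inj; rewrite -(size_prod_XsubC rs id) -pE size_XnsubC.
- by move=> z; rewrite -root_prod_XsubC -pE /root !hornerE subr_eq0.
Qed.

Lemma nth_roots_of_seq (m : nat) (W : seq R[i]) : (0 < m)%N -> uniq W -> 0 \notin W ->
  exists T : seq R[i], [/\ uniq T, size T = (m * size W)%N & forall z, (z \in T) = (z ^+ m \in W)].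
Proof.
move=> m0; elim: W => [|w W IH] /=; first by exists [::]; rewrite muln0.
move=> /andP[wW uW]; rewrite inE negb_or eq_sym => /andP[w0 W0].
have [T [uT sT TP]] := IH uW W0; have [rs [urs srs rsP _]] := nth_roots m0 w0.
exists (rs ++ T); split.
- rewrite cat_uniq urs uT andbT; apply/hasPn => z; rewrite TP => zW.
  by apply/negP; rewrite /= rsP => /eqP zw; move: wW; rewrite -zw zW.
- by rewrite size_cat srs sT mulnS.
- by move=> z; rewrite mem_cat rsP TP inE.
Qed.

Lemma log_deriv_prod (rs : seq R[i]) (z : R[i]) : z \notin rs ->
  let p := \prod_(r <- rs) ('X - r%:P) in p^`().[z] / p.[z] = \sum_(r <- rs) (z - r)^-1.
Proof.
elim: rs => [|r rs IH] /=; first by rewrite !big_nil derivC horner0 mul0r.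
rewrite inE negb_or => /andP[zr /[dup] zrs /IH IHz].
rewrite !big_cons -IHz derivM derivXsubC mul1r !hornerE.
have p0 : (\prod_(r <- rs) ('X - r%:P)).[z] != 0.
  by rewrite -[_ == 0]/(root _ _) root_prod_XsubC.
have zr0 : z - r != 0 by rewrite subr_eq0.
by field; rewrite p0 zr0.
Qed.

(** The sum of 1 / (z - r) is the logarithmic derivative of X^m - a; masses 1 / m cancel the factor
    m. *)
Lemma lens_field_roots (m : nat) (a z : R[i]) (rs : seq R[i]) : (0 < m)%N -> z \notin rs ->
  'X^m - a%:P = \prod_(r <- rs) ('X - r%:P) ->
  lens_field rs (fun=> m%:R^-1) z = z ^+ m.-1 / (z ^+ m - a).
Proof.
move=> m0 zrs pE.
rewrite /lens_field -mulr_sumr.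
have := log_deriv_prod zrs; rewrite /= -pE => <-.
have -> : (m%:R^-1 : R)%:C = (m%:R : R[i])^-1 by rewrite fmorphV rmorph_nat.
rewrite derivB derivXn derivC subr0 hornerMn !hornerE -[z ^+ m.-1 *+ m]mulr_natl /=.
by rewrite !mulrA mulVf ?mul1r// pnatr_eq0 -lt0n.
Qed.

Section RadialEquation.
Context (m : nat) (A e : R) (m0 : (0 < m)%N) (A0 : 0 < A).

(** With w = z^m and r = |z| the equation reads (r^2 - e) (w - A) = w. Its coefficients are real,
    which forces w to be real, so w is r^m or -r^m. *)
Lemma critical_equation_radial (z : R[i]) : z != 0 ->
  (z ^+ m != A%:C /\ z^*%C = e%:C / z + z ^+ m.-1 / (z ^+ m - A%:C)) <->
  ((exists t, [/\ 0 < t, (t ^+ 2 - e) * (t ^+ m - A) = t ^+ m & z ^+ m = (t ^+ m)%:C]) \/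
   (exists t, [/\ 0 < t, (t ^+ 2 - e) * (t ^+ m + A) = t ^+ m & z ^+ m = (- t ^+ m)%:C])).
Proof.
move=> z0; set r := normc z; have r0 : 0 < r by rewrite normc_gt0.
have zz : z * z^*%C = (r ^+ 2)%:C.
  by rewrite -sqr_normc normCE rmorphXn.
have eqv : z ^+ m != A%:C ->
    (z^*%C = e%:C / z + z ^+ m.-1 / (z ^+ m - A%:C)) <->
    ((r ^+ 2 - e)%:C * (z ^+ m - A%:C) = z ^+ m).
  rewrite -subr_eq0 => wA.
  have -> : (r ^+ 2 - e)%:C = z * z^*%C - e%:C by rewrite zz -rmorphB.
  have -> : z ^+ m.-1 = z ^+ m / z by rewrite -[in z ^+ m](prednK m0) exprS mulrAC mulfV ?mul1r.
  split=> [->|H]; first by field; rewrite z0 wA.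
  apply: (mulfI z0); apply: (mulIf wA).
  have -> : z * (e%:C / z + z ^+ m / z / (z ^+ m - A%:C)) * (z ^+ m - A%:C) =
    e%:C * (z ^+ m - A%:C) + z ^+ m by field; rewrite z0 wA.
  transitivity (e%:C * (z ^+ m - A%:C) + (z * z^*%C - e%:C) * (z ^+ m - A%:C)); first by ring.
  by rewrite H.
have rm : normc (z ^+ m) = r ^+ m by rewrite normcX.
split=> [[wA /(eqv wA)]|].
  case: (z ^+ m) rm {eqv wA} => x y /= xy E.
  have [Ex Ey] : (r ^+ 2 - e) * (x - A) = x /\ (r ^+ 2 - e) * y = y.
    by case: E; rewrite !mul0r subr0 addr0 oppr0 addr0 => -> ->.
  (* Otherwise r^2 - e = 1, and the real part would read x - A = x. *)
  have y0 : y = 0.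
    apply/eqP; have : (r ^+ 2 - e - 1) * y = 0 by rewrite mulrBl Ey mul1r subrr.
    move/eqP; rewrite mulf_eq0 => /orP[/eqP h|//].
    by have : A = 0; [move: Ex; have -> : r ^+ 2 - e = 1 by lra|move: A0]; lra.
  move: xy; rewrite y0 expr0n addr0 sqrtr_sqr => xr.
  have [x0|x0] := leP 0 x.
    by left; exists r; split=> //; rewrite -xr ger0_norm.
  by right; exists r; split=> //; rewrite -xr ltr0_norm ?opprK//; lra.
have normE t : 0 < t -> normc (z ^+ m) = t ^+ m -> r = t.
  move=> t0; rewrite rm => /eqP; rewrite eqrXn2 ?ltW//; first by move/eqP.
move=> [[t [t0 Et zt]]|[t [t0 Et zt]]].
  have tm0 : 0 < t ^+ m by rewrite exprn_gt0.
  have rt : r = t by apply: normE => //; rewrite zt normcR ger0_norm ?ltW.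
  have wA : z ^+ m != A%:C.
    apply/eqP; rewrite zt => /complexI tA; move: Et; rewrite tA subrr mulr0 => hA.
    by move: A0; rewrite -hA ltxx.
  by split=> //; apply/(eqv wA); rewrite zt rt -rmorphB -rmorphM Et.
have tm0 : 0 < t ^+ m by rewrite exprn_gt0.
have rt : r = t by apply: normE => //; rewrite zt normcR normrN ger0_norm ?ltW.
have wA : z ^+ m != A%:C.
  by apply/eqP; rewrite zt => /complexI tA; move: A0 tm0; rewrite -tA; lra.
split=> //; apply/(eqv wA); rewrite zt rt -rmorphB -rmorphM; congr _%:C.
by rewrite -opprD mulrN Et.
Qed.

(** Each radius fixes one nonzero value of z^m, positive for [Tp] and negative for [Tm]. These
    values are distinct, and each has m preimages. *)
Lemma card_nonzero_critical (Tp Tm : seq R) :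
  uniq Tp -> uniq Tm -> {in Tp, forall t, 0 < t} -> {in Tm, forall t, 0 < t} ->
  (forall t, 0 < t -> (t ^+ 2 - e) * (t ^+ m - A) = t ^+ m <-> t \in Tp) ->
  (forall t, 0 < t -> (t ^+ 2 - e) * (t ^+ m + A) = t ^+ m <-> t \in Tm) ->
  exists T : seq R[i], [/\ uniq T, size T = (m * (size Tp + size Tm))%N, 0 \notin T &
    forall z, z != 0 -> (z \in T) <->
      (z ^+ m != A%:C /\ z^*%C = e%:C / z + z ^+ m.-1 / (z ^+ m - A%:C))].
Proof.
move=> up um p0 n0 pP nP.
pose W := [seq (t ^+ m)%:C | t <- Tp] ++ [seq (- t ^+ m)%:C | t <- Tm].
have inj (T : seq R) : {in T, forall t, 0 < t} -> {in T &, forall x y, x ^+ m = y ^+ m -> x = y}.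
  by move=> T0 x y xT yT /eqP; rewrite eqrXn2 ?ltW ?T0//; move/eqP.
have uW : uniq W.
  rewrite cat_uniq; apply/and3P; split.
  - by rewrite map_inj_in_uniq// => x y xT yT /complexI/(inj _ p0); apply.
  - apply/hasPn => _ /mapP[t tT ->]; apply/negP => /mapP[u uT /complexI].
    have := exprn_gt0 m (n0 _ tT); have := exprn_gt0 m (p0 _ uT); lra.
  - by rewrite map_inj_in_uniq// => x y xT yT /complexI/oppr_inj/(inj _ n0); apply.
have W0 : 0 \notin W.
  rewrite mem_cat negb_or; apply/andP; split; apply/negP => /mapP[t tT [] /eqP].
    by rewrite eq_sym gt_eqF// exprn_gt0// p0.
  by rewrite eq_sym oppr_eq0 gt_eqF// exprn_gt0// n0.
have [T [uT sT TP]] := nth_roots_of_seq m0 uW W0.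
exists T; split=> //.
- by rewrite sT size_cat !size_map.
- by rewrite TP expr0n gtn_eqF.
move=> z z0; rewrite (critical_equation_radial z0) TP mem_cat; split.
  move=> /orP[/mapP[t tT zt]|/mapP[t tT zt]]; [left|right]; exists t; split=> //.
  - exact: p0.
  - by apply/pP => //; exact: p0.
  - exact: n0.
  - by apply/nP => //; exact: n0.
move=> [[t [t0 /(pP _ t0) tT zt]]|[t [t0 /(nP _ t0) tT zt]]]; apply/orP.
  by left; apply/mapP; exists t.
by right; apply/mapP; exists t.
Qed.
End RadialEquation.
End Counting.

(** * Positive roots of the two radial equations *)

Section RadialRoots.
Variable R : realType.
Implicit Types (p q : {poly R}).

(** At least n distinct positive roots; the strict order puts consecutive entries in position for
    Rolle's theorem. *)
Definition positive_roots p (n : nat) := exists s : seq R,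
  [/\ sorted <%R s, size s = n & {in s, forall x, 0 < x /\ root p x}].

Lemma positive_roots_deriv p n : positive_roots p n.+1 -> positive_roots p^`() n.
Proof.
move=> [[|x s] [//= ps [sn] sP]].
(* Asking for a path from x carries both the order and the lower bound through the induction;
   positivity follows from that of x. *)
suff [s' [ps' ss' s'P]] : exists s', [/\ path <%R x s', size s' = n & {in s', forall x, root p^`() x}].
  exists s'; split=> //; first exact: path_sorted ps'.
  move=> y ys'; split; last exact: s'P.
  by apply: lt_trans (allP (lt_path_min ps') y ys'); case: (sP x (mem_head _ _)).
have rx : root p x by case: (sP x (mem_head _ _)).
have {sP} sP : {in s, forall x, root p x}.
  by move=> y ys; case: (sP y _) => //; rewrite inE ys orbT.
elim: s x n ps sn rx sP => [|y s IH] x n /=; first by exists [::].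
move=> /andP[xy ps] <- rx sP.
have ry : root p y by apply: sP; exact: mem_head.
have [|s' [ps' ss' s'P]] := IH y _ ps erefl ry; first by move=> z zs; apply: sP; rewrite inE zs orbT.
have [c] := @polyrcf.poly_rolle _ x y p xy (etrans (eqP rx) (esym (eqP ry))).
rewrite in_itv/= => /andP[xc cy] dc; exists (c :: s'); split=> //=.
- rewrite xc /=; case: s' ps' {ss' s'P} => //= z s' /andP[yz ->]; rewrite andbT.
  exact: lt_trans yz.
- by rewrite ss'.
- by move=> z; rewrite inE => /predU1P[->|/s'P//]; rewrite /root dc.
Qed.

Lemma positive_roots_mulXn p k n : positive_roots ('X^k * p) n -> positive_roots p n.
Proof.
move=> [s [ss sn sP]]; exists s; split=> // x /sP[x0]; split=> //.
by move: b; rewrite rootM => /orP[|//]; rewrite /root !hornerE expf_eq0 gt_eqF ?andbF.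
Qed.

Lemma derivXn_polyC (j : nat) : ('X^j)^`() = j%:R%:P * 'X^(j.-1) :> {poly R}.
Proof. by rewrite derivXn mul_polyC scaler_nat. Qed.

(* Four alternating coefficients: three applications of Rolle's theorem leave a binomial. *)
Lemma at_most_three_positive_roots (k : nat) (a b c d : R) : 0 < d ->
  ~ positive_roots (a%:P - b *: 'X^2 + c *: 'X^(k.+3) - d *: 'X^(k.+3 + 2)) 4.
Proof.
move=> d0 /positive_roots_deriv.
(* Each differentiation costs one root and kills the constant term, and the power of X then factored
   out has no positive root. After two rounds two roots x < y remain for C - D X^2, which is absurd
   as D > 0. *)
have -> : (a%:P - b *: 'X^2 + c *: 'X^(k.+3) - d *: 'X^(k.+3 + 2))^`() =
    'X^1 * ((- (2 * b))%:P + (c * k.+3%:R) *: 'X^(k.+1) - (d * (k.+3 + 2)%:R) *: 'X^(k.+3)).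
  rewrite derivB !derivD derivN derivC !derivZ !derivXn_polyC addn2 /= -!mul_polyC.
  rewrite !polyCN !polyCM !exprS !expr0.
  move: (k.+3%:R : R)%:P (k.+4.+1%:R : R)%:P => u v. ring.
move=> /positive_roots_mulXn/positive_roots_deriv.
have -> : ((- (2 * b))%:P + (c * k.+3%:R) *: 'X^(k.+1) - (d * (k.+3 + 2)%:R) *: 'X^(k.+3))^`() =
    'X^k * ((c * k.+3%:R * k.+1%:R)%:P - (d * (k.+3 + 2)%:R * k.+3%:R) *: 'X^2).
  rewrite derivB !derivD derivC !derivZ !derivXn_polyC addn2 /= -!mul_polyC.
  rewrite !polyCM !exprS !expr0.
  move: (k.+3%:R : R)%:P (k.+4.+1%:R : R)%:P (k.+1%:R : R)%:P => u v w. ring.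
move=> /positive_roots_mulXn[s [ss sn sP]].
case: s ss sn sP => [|x [|y [|]]] //= /andP[xy _] _ sP.
have [x0] := sP x (mem_head _ _).
have [y0] := sP y (mem_last x [:: y]).
rewrite /root !hornerE => /eqP hy /eqP hx.
have D0 : 0 < d * (k.+3 + 2)%:R * k.+3%:R by rewrite !mulr_gt0// ltr0n addn2.
move: hx hy D0; set D := d * _ * _; set C := c * _ * _ => hx hy D0.
have : D * x ^+ 2 < D * y ^+ 2 by rewrite ltr_pM2l// ltr_pXn2r ?nnegrE ?ltW.
by rewrite !expr2 !mulrA -(subr0_eq hx) -(subr0_eq hy) ltxx.
Qed.

Lemma three_roots_exhaust p (t1 t2 t3 t : R) : ~ positive_roots p 4 ->
  0 < t1 -> t1 < t2 -> t2 < t3 -> root p t1 -> root p t2 -> root p t3 ->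
  0 < t -> root p t -> t \in [:: t1; t2; t3].
Proof.
move=> p4 t10 t12 t23 r1 r2 r3 t0 rt; apply: contrapT => /negP tn; apply: p4.
exists (sort <=%R [:: t; t1; t2; t3]); split.
- rewrite sort_lt_sorted cons_uniq tn /= !inE !negb_or !(lt_eqF t12) !(lt_eqF t23).
  by rewrite (lt_eqF (lt_trans t12 t23)).
- by rewrite size_sort.
- move=> x; rewrite mem_sort !inE => /or4P[] /eqP -> //; split=> //; lra.
Qed.

Lemma mulr_pos_neg (x y : R) : 0 < x -> y < 0 -> x * y < 0.
Proof. by move=> x0; rewrite pmulr_rlt0. Qed.

Lemma mulr_neg_pos (x y : R) : x < 0 -> 0 < y -> x * y < 0.
Proof. by move=> x0; rewrite nmulr_rlt0. Qed.

Section SmallCentralMass.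
Context (k : nat).
Let m := k.+3.
(** With this A the outer masses lie at radius 1/2, a convenient point for reading off signs. The
    point s = A / 8 is a further test point: there the term A s^2 / 2 = 4 s^3 outweighs s^m <=
    s^3. *)
Let A : R := 2^-1 ^+ m.
Let s : R := A / 8.
Let e : R := s ^+ 2 / 2.

Lemma small_mass_gt0 : 0 < A. Proof. by rewrite exprn_gt0. Qed.

Lemma small_radius : 0 < s < 2^-1.
Proof.
have A0 := small_mass_gt0; rewrite /s divr_gt0//=.
have : A <= 1 by rewrite exprn_ile1//; lra.
lra.
Qed.

Lemma small_center_gt0 : 0 < e.
Proof. by have /andP[s0 _] := small_radius; rewrite divr_gt0// exprn_gt0. Qed.

Lemma small_center_lt : e < 2^-1 ^+ 2.
Proof.
have /andP[s0 s1] := small_radius; rewrite /e.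
have : s ^+ 2 < 2^-1 ^+ 2 by rewrite ltr_pXn2r ?nnegrE ?ltW.
by have := exprn_gt0 2 s0; lra.
Qed.

(** Expanded, with the coefficient 1 written out, to match [at_most_three_positive_roots]. *)
Let pm : {poly R} := (A * e)%:P - A *: 'X^2 + (1 + e) *: 'X^m - 1 *: 'X^(m + 2).

Lemma pmE t : pm.[t] = t ^+ m - (t ^+ 2 - e) * (t ^+ m + A).
Proof.
by rewrite /pm !(hornerD, hornerN, hornerC, hornerZ, hornerXn) exprD; move: (t ^+ m) => x; ring.
Qed.

(** The signs +, -, +, - at 0, s, 1/2, 2 give three roots, and Rolle's theorem excludes a fourth. *)
Lemma minus_radii : exists T : seq R, [/\ uniq T, size T = 3, {in T, forall t, 0 < t} &
  forall t, 0 < t -> (t ^+ 2 - e) * (t ^+ m + A) = t ^+ m <-> t \in T].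
Proof.
have A0 := small_mass_gt0; have /andP[s0 s12] := small_radius; have e0 := small_center_gt0.
have e1 := small_center_lt.
have h0 : 0 < pm.[0] by rewrite pmE expr0n /= expr0n /=; nra.
have hs : pm.[s] < 0.
  rewrite pmE; have sm : s ^+ m <= s ^+ 3.
    rewrite /m -addn3 exprD; apply: ler_piMl; first by rewrite exprn_ge0// ltW.
    by apply: exprn_ile1; lra.
  have As : A = 8 * s by rewrite /s; field.
  have sm0 := exprn_gt0 m s0; have s30 := exprn_gt0 3 s0.
  have : (s ^+ 2 - e) * (s ^+ m + A) = s ^+ 2 / 2 * s ^+ m + 4 * s ^+ 3.
    by rewrite As /e; field.
  have := mulr_gt0 (divr_gt0 (exprn_gt0 2 s0) (ltr0n R 2)) sm0; lra.
have h12 : 0 < pm.[2^-1].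
  by rewrite pmE -/A; nra.
have h2 : pm.[2] < 0.
  rewrite pmE; have : 1 <= 2 ^+ m :> R by rewrite exprn_ege1//; lra.
  by nra.
have [t1 + r1] := @polyrcf.poly_ivtoo _ pm 0 s (ltW s0) (mulr_pos_neg h0 hs).
have [t2 + r2] := @polyrcf.poly_ivtoo _ pm s 2^-1 (ltW s12) (mulr_neg_pos hs h12).
have h122 : 2^-1 <= 2 :> R by lra.
have [t3 + r3] := @polyrcf.poly_ivtoo _ pm 2^-1 2 h122 (mulr_pos_neg h12 h2).
rewrite !in_itv/= => /andP[t3l t3h] /andP[t2l t2h] /andP[t1l t1h].
have t12 : t1 < t2 by lra.
have t23 : t2 < t3 by lra.
exists [:: t1; t2; t3]; split=> //.
- by rewrite /= !inE !negb_or !(lt_eqF t12) !(lt_eqF t23) (lt_eqF (lt_trans t12 t23)).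
- by move=> t; rewrite !inE => /or3P[] /eqP ->; lra.
have rE t : root pm t <-> (t ^+ 2 - e) * (t ^+ m + A) = t ^+ m.
  rewrite /root pmE subr_eq0; split; first by move/eqP.
  by move=> ->.
move=> t t0; rewrite -rE; split.
  by apply: three_roots_exhaust => //; exact: at_most_three_positive_roots.
by rewrite !inE => /or3P[] /eqP ->.
Qed.

Let pp : {poly R} := ('X^2 - e%:P) * ('X^m - A%:P) - 'X^m.

Lemma ppE t : pp.[t] = (t ^+ 2 - e) * (t ^+ m - A) - t ^+ m.
Proof. by rewrite /pp hornerD hornerN hornerM !(hornerD, hornerN, hornerC, hornerXn). Qed.

(** The signs +, -, + at 0, 1/2, 2 give a root on each side of 1/2; monotonicity makes each unique
    on its side, where t^m < A or t^m > A. *)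
Lemma plus_radii : exists T : seq R, [/\ uniq T, size T = 2, {in T, forall t, 0 < t} &
  forall t, 0 < t -> (t ^+ 2 - e) * (t ^+ m - A) = t ^+ m <-> t \in T].
Proof.
have A0 := small_mass_gt0; have e0 := small_center_gt0; have e1 := small_center_lt.
have h0 : 0 < pp.[0] by rewrite ppE expr0n /= expr0n /=; nra.
have h12 : pp.[2^-1] < 0 by rewrite ppE -/A; lra.
have A1 : A <= 1 by rewrite exprn_ile1//; lra.
have h2 : 0 < pp.[2].
  rewrite ppE; have : 2 ^+ 3 <= 2 ^+ m :> R by apply: ler_weXn2l => //; lra.
  by nra.
have h012 : 0 <= 2^-1 :> R by lra.
have [t1 + r1] := @polyrcf.poly_ivtoo _ pp 0 2^-1 h012 (mulr_pos_neg h0 h12).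
have h122 : 2^-1 <= 2 :> R by lra.
have [t2 + r2] := @polyrcf.poly_ivtoo _ pp 2^-1 2 h122 (mulr_neg_pos h12 h2).
rewrite !in_itv/= => /andP[t2l t2h] /andP[t1l t1h].
have rE t : root pp t <-> (t ^+ 2 - e) * (t ^+ m - A) = t ^+ m.
  rewrite /root ppE subr_eq0; split; first by move/eqP.
  by move=> ->.
have t20 : 0 < t2 by lra.
have mlt (x y : R) : 0 < x -> x < y -> x ^+ m < y ^+ m.
  by move=> x0 xy; rewrite ltr_pXn2r ?nnegrE ?ltW//; lra.
have m2lt (x y : R) : 0 < x -> x < y -> x ^+ 2 < y ^+ 2.
  by move=> x0 xy; rewrite ltr_pXn2r ?nnegrE ?ltW//; lra.
have A1m : t1 ^+ m < A by apply: mlt.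
have A2m : A < t2 ^+ m by apply: mlt => //; lra.
(* Here (e - t^2) (A - t^m) = t^m with both factors positive: the left side decreases in t and the
   right side increases. *)
have below x y : 0 < x -> x < y -> y ^+ m < A -> root pp x -> root pp y -> False.
  move=> x0 xy yA /rE Ex /rE Ey; have := mlt _ _ x0 xy; have := m2lt _ _ x0 xy.
  have := exprn_gt0 m x0; have y0 : 0 < y by lra.
  have := exprn_gt0 m y0; move: Ex Ey yA.
  move: (x ^+ m) (y ^+ m) (x ^+ 2) (y ^+ 2) => X Y X2 Y2 Ex Ey YA Y0 X0 h1 h2'.
  have hY : 0 < e - Y2 by nra.
  by nra.
(* Rewritten as (t^2 - e - 1) (t^m - A) = A: both factors are positive and increasing, while the
   right side is constant. *)
have above x y : 0 < x -> x < y -> A < x ^+ m -> root pp x -> root pp y -> False.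
  move=> x0 xy xA /rE Ex /rE Ey; have := mlt _ _ x0 xy; have := m2lt _ _ x0 xy.
  move: Ex Ey xA.
  move: (x ^+ m) (y ^+ m) (x ^+ 2) (y ^+ 2) => X Y X2 Y2 Ex Ey XA h1 h2'.
  have Ex' : (X2 - e - 1) * (X - A) = A by lra.
  have Ey' : (Y2 - e - 1) * (Y - A) = A by lra.
  have hX : 0 < X2 - e - 1 by nra.
  by nra.
exists [:: t1; t2]; split=> //.
- by rewrite /= inE andbT lt_eqF//; lra.
- by move=> t; rewrite !inE => /orP[] /eqP ->; lra.
move=> t t0; rewrite -rE; split; last by rewrite !inE => /orP[] /eqP ->.
move=> rt; rewrite !inE; have [tA|tA|tA] := ltgtP (t ^+ m) A.
- have [tt|tt|->] := ltgtP t t1; last by rewrite ?eqxx.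
    by case: (below _ _ t0 tt A1m rt r1).
  by case: (below _ _ t1l tt tA r1 rt).
- have [tt|tt|->] := ltgtP t t2; last by rewrite ?eqxx ?orbT.
    by case: (above _ _ t0 tt tA rt r2).
  by case: (above _ _ t20 tt A2m r2 rt).
- have /rE := rt; rewrite tA subrr mulr0; lra.
Qed.
End SmallCentralMass.

End RadialRoots.

(** * Lenses with 5n - 5 solutions *)

Section Lenses.
Variable R : realType.

Section Polygon.
Context (m : nat) (A e : R) (Tp Tm : seq R) (A0 : 0 < A).
Hypotheses (up : uniq Tp) (um : uniq Tm).
Hypotheses (p0 : {in Tp, forall t, 0 < t}) (n0 : {in Tm, forall t, 0 < t}).
Hypothesis pP : forall t, 0 < t -> (t ^+ 2 - e) * (t ^+ m - A) = t ^+ m <-> t \in Tp.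
Hypothesis nP : forall t, 0 < t -> (t ^+ 2 - e) * (t ^+ m + A) = t ^+ m <-> t \in Tm.

Lemma polygon_poles : (0 < m)%N -> exists rs : seq R[i],
  [/\ uniq rs, size rs = m, forall z, (z \in rs) = (z ^+ m == A%:C), 0 \notin rs &
    forall z, z \notin rs -> lens_field rs (fun=> m%:R^-1) z = z ^+ m.-1 / (z ^+ m - A%:C)].
Proof.
move=> m0; have AC0 : A%:C != 0 by rewrite eq_complex /= eqxx andbT gt_eqF.
have [rs [urs srs rsP rsE]] := nth_roots m0 AC0; exists rs; split=> //.
  by rewrite rsP expr0n gtn_eqF// eq_sym.
by move=> z zrs; exact: lens_field_roots.
Qed.

Lemma polygon_lens : e = 0 -> (1 < m)%N -> exists (S : seq R[i]) (c : R[i] -> R),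
  [/\ uniq S, size S = m, forall s, s \in S -> 0 < c s &
    [set z | z \notin S /\ z^*%C = lens_field S c z] #= `I_(m * (size Tp + size Tm)).+1].
Proof.
move=> e0 m1; have m0 : (0 < m)%N by exact: ltnW.
have [rs [urs srs rsP rs0 fE]] := polygon_poles m0.
have [T [uT sT T0 TP]] := card_nonzero_critical m0 A0 up um p0 n0 pP nP.
exists rs, (fun=> m%:R^-1); split=> //; first by move=> s _; rewrite invr_gt0 ltr0n.
rewrite -sT -[X in `I_X]/(size (0 :: T)).
suff -> : [set z | z \notin rs /\ z^*%C = lens_field rs (fun=> m%:R^-1) z] = [set` 0 :: T].
  by apply: (card_seq_set 0); rewrite /= T0.
apply/seteqP; split=> z /=.
  move=> [zrs zE]; rewrite inE; have [//|z0/=] := eqVneq z 0.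
  apply/TP => //; split; first by rewrite -rsP.
  by rewrite zE fE// e0 mul0r add0r.
rewrite inE; have [-> _|z0 /= zT] := eqVneq z 0.
  (* The origin is a solution because the field carries the factor z^(m-1), with m > 1. *)
  split=> //; rewrite fE// conjc0 expr0n -subn1 subn_eq0 leqNgt m1 mul0r.
  by [].
have [zA zE] := (TP z z0).1 zT; have zrs : z \notin rs by rewrite rsP.
by split=> //; rewrite zE fE// e0 mul0r add0r.
Qed.

Lemma centered_polygon_lens : 0 < e -> (0 < m)%N -> exists (S : seq R[i]) (c : R[i] -> R),
  [/\ uniq S, size S = m.+1, forall s, s \in S -> 0 < c s &
    [set z | z \notin S /\ z^*%C = lens_field S c z] #= `I_(m * (size Tp + size Tm))].
Proof.
move=> e0 m0.
have [rs [urs srs rsP rs0 fE]] := polygon_poles m0.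
have [T [uT sT T0 TP]] := card_nonzero_critical m0 A0 up um p0 n0 pP nP.
pose c (s : R[i]) : R := if s == 0 then e else m%:R^-1.
have cE z : z \notin rs -> lens_field (0 :: rs) c z = e%:C / z + z ^+ m.-1 / (z ^+ m - A%:C).
  move=> zrs; rewrite -fE// /lens_field big_cons {1}/c eqxx subr0; congr (_ + _).
  rewrite big_seq [RHS]big_seq; apply: eq_bigr => s srs'.
  by rewrite /c ifF//; apply: contraNF rs0 => /eqP <-.
exists (0 :: rs), c; split.
- by rewrite /= rs0.
- by rewrite /= srs.
- by move=> s _; rewrite /c; case: ifP => // _; rewrite invr_gt0 ltr0n.
rewrite -sT.
suff -> : [set z | z \notin 0 :: rs /\ z^*%C = lens_field (0 :: rs) c z] = [set` T].
  exact: (card_seq_set 0).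
apply/seteqP; split=> z /=.
  rewrite inE negb_or => -[/andP[z0 zrs]]; rewrite cE// => zE.
  by apply/TP => //; split=> //; rewrite -rsP.
move=> zT; have z0 : z != 0 by apply: contraNneq T0 => <-.
have [zA zE] := (TP z z0).1 zT; have zrs : z \notin rs by rewrite rsP.
by rewrite inE negb_or z0 zrs cE.
Qed.
End Polygon.

Lemma lens_exists (n : nat) : (2 <= n)%N -> exists (S : seq R[i]) (c : R[i] -> R),
  [/\ uniq S, size S = n, forall s, s \in S -> 0 < c s &
    [set z | z \notin S /\ z^*%C = lens_field S c z] #= `I_(5 * n - 5)].
Proof.
case: n => [|[|[|[|k]]]] // _.
(* The equations reduce to t^2 = 1 + A and t^2 = 1 - A; A = 24/25 makes both right sides rational
   squares, 49/25 and 1/25. *)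
- apply: (@polygon_lens 2 (24 / 25) 0 [:: 7 / 5] [:: 1 / 5]).
  + lra.
  + by [].
  + by [].
  + by move=> t; rewrite inE => /eqP ->; lra.
  + by move=> t; rewrite inE => /eqP ->; lra.
  + move=> t t0; rewrite inE; split=> [E|/eqP ->]; last by field.
    have {}E : t ^+ 2 * ((t - 7 / 5) * (t + 7 / 5)) = 0.
      by rewrite -[RHS](subrr (t ^+ 2)) -[X in _ = X - _]E; field.
    move/eqP: E; rewrite mulf_eq0 expf_eq0 /= (gt_eqF t0) /= !mulf_eq0 => /orP[|/eqP]; last lra.
    by rewrite subr_eq0.
  + move=> t t0; rewrite inE; split=> [E|/eqP ->]; last by field.
    have {}E : t ^+ 2 * ((t - 1 / 5) * (t + 1 / 5)) = 0.
      by rewrite -[RHS](subrr (t ^+ 2)) -[X in _ = X - _]E; field.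
    move/eqP: E; rewrite mulf_eq0 expf_eq0 /= (gt_eqF t0) /= !mulf_eq0 => /orP[|/eqP]; last lra.
    by rewrite subr_eq0.
  + by [].
  + by [].
(* The equations reduce to t^3 - t = A and t^3 - t = -A. Since 3^2 + 3 * 5 + 5^2 = 7^2, the numbers
   8/7, -3/7, -5/7 have sum 0, pairwise products summing to -1, and product A. *)
- apply: (@polygon_lens 3 (120 / 343) 0 [:: 8 / 7] [:: 3 / 7; 5 / 7]).
  + lra.
  + by [].
  + by rewrite /= inE andbT; apply/eqP; lra.
  + by move=> t; rewrite inE => /eqP ->; lra.
  + by move=> t; rewrite !inE => /orP[] /eqP ->; lra.
  + move=> t t0; rewrite inE; split=> [E|/eqP ->]; last by field.
    have {}E : t ^+ 2 * ((t - 8 / 7) * ((t + 3 / 7) * (t + 5 / 7))) = 0.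
      by rewrite -[RHS](subrr (t ^+ 3)) -[X in _ = X - _]E; field.
    move/eqP: E; rewrite mulf_eq0 expf_eq0 /= (gt_eqF t0) /= !mulf_eq0 => /or3P[|/eqP|/eqP]; lra.
  + move=> t t0; rewrite !inE; split=> [E|/orP[]/eqP ->]; try by field.
    have {}E : t ^+ 2 * ((t - 3 / 7) * ((t - 5 / 7) * (t + 8 / 7))) = 0.
      by rewrite -[RHS](subrr (t ^+ 3)) -[X in _ = X - _]E; field.
    move/eqP: E; rewrite mulf_eq0 expf_eq0 /= (gt_eqF t0) /= !mulf_eq0 => /or3P[||/eqP]; last lra.
      by rewrite subr_eq0 => ->.
    by rewrite subr_eq0 => ->; rewrite orbT.
  + by [].
  + by [].
have [Tp [up sp p0 pP]] := plus_radii R k; have [Tm [um sm n0 nP]] := minus_radii R k.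
(* With n - 1 masses on the circle, the 2 + 3 radii give 5 (n - 1) solutions; the origin now carries
   a mass and is not one of them. *)
have -> : (5 * k.+4 - 5 = k.+3 * (size Tp + size Tm))%N by rewrite sp sm mulnC mulSn addKn.
apply: (centered_polygon_lens (small_mass_gt0 R k) up um p0 n0 pP nP (small_center_gt0 R k)) => //.
Qed.
End Lenses.

Theorem mainTheorem2 (R : realType) (n : nat) (hn : (2 <= n)%N) :
  exists Omega : set R[i],
    [/\ RL_domain_of_order n Omega,
        has_connectivity Omega n.+1
      & exists v : R[i] -> R,
          landscape_function Omega v /\
          critical_points Omega v #= `I_(5 * n - 5)].
Proof.
have [S [c [uS <- c0 cZ]]] := lens_exists R hn.
exact: (lens_landscape uS c0 cZ).
Qed.
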